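(* Let $q\ge 3$ be a power of a prime $p$, let $\mathcal{C}$ be the DGZ curve, and let $S=\sum v_P(S)P$ be the Stöhr–Voloch divisor over $\mathbb{F}_q$ of the linear series cut out on $\mathcal{C}$ by lines. Then, for $P\in\mathcal{C}$, $$v_P(S)=\begin{cases} 1, & P\in\mathcal{C}(\mathbb{F}_{q^3}),\\ 0, & \text{otherwise.}\end{cases}$$
   Context: Let $\mathbb{K}=\overline{\mathbb{F}}_q$. Put $D_1(x,y,z)=\begin{vmatrix} x & x^q & x^{q^3}\\ y & y^q & y^{q^3}\\ z & z^q & z^{q^3}\end{vmatrix}$, $D_2(x,y,z)=\begin{vmatrix} x & x^q & x^{q^2}\\ y & y^q & y^{q^2}\\ z & z^q & z^{q^2}\end{vmatrix}$ and $F=D_1/D_2$, an absolutely irreducible homogeneous polynomial of degree $q^3-q^2$ over $\mathbb{F}_q$. The DGZ curve $\mathcal{C}$ is the plane curve over $\mathbb{K}$ with equation $F(x,y,z)=0$; its function field is $\mathbb{K}(\mathcal{C})=\mathbb{K}(x,y)$ with $F(x,y,1)=0$. Each point of $\mathcal{C}$ is the center of exactly one branch, so points of $\mathcal{C}$ are identified with points of a nonsingular model $\mathcal{X}$ (places of $\mathbb{K}(\mathcal{C})$), and divisors are divisors on $\mathcal{X}$. $\mathcal{C}(\mathbb{F}_{q^3})$ is the set of points of $\mathcal{C}$ in $PG(2,\mathbb{F}_{q^3})$. The function $x$ is a separating variable, and $D^{(i)}$ denotes the $i$-th Hasse derivative with respect to $x$. The $\mathbb{F}_q$-Frobenius order sequence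 of the linear series cut out by lines is $(\nu_0,\nu_1)=(0,q)$. The Stöhr–Voloch divisor over $\mathbb{F}_q$ is $$S=\mathrm{div}(W_S)+q\,\mathrm{div}(dx)+(q+2)V,\qquad W_S=\begin{vmatrix} x^q & y^q & 1\\ x & y & 1\\ D^{(q)}(x) & D^{(q)}(y) & 0\end{vmatrix}=(x-x^q)D^{(q)}(y),$$ where $V$ is the intersection divisor of $\mathcal{C}$ with the line $z=0$ (so $V=\sum qP_i$ over the $q^2-q$ points $P_i$ of $\mathcal{C}$ on that line), and $v_P(S)$ is the coefficient of $P$ in $S$. *)

(* Defs.v *)
From HB Require Import structures.
From mathcomp Require Import all_boot all_order all_algebra all_field.
From mathcomp Require Import mpoly.

Set Implicit Arguments.
Unset Strict Implicit.
Unset Printing Implicit Defensive.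

Import Order.TTheory GRing.Theory Num.Theory.
Local Open Scope ring_scope.

(* With ('X_0, 'X_1, 'X_2) = (x, y, z), the determinant whose rows are
   (w^(q^a), w^(q^b), w^(q^c)) for w = x, y, z. *)
Definition moore_det (R : comNzRingType) (q a b c : nat) : {mpoly R[3]} :=
  \det (\matrix_(i < 3, j < 3)
          ('X_i : {mpoly R[3]}) ^+ (q ^ tnth [tuple a; b; c] j)%N).

Definition D1 (R : comNzRingType) (q : nat) : {mpoly R[3]} :=
  moore_det R q 0 1 3.

Definition D2 (R : comNzRingType) (q : nat) : {mpoly R[3]} :=
  moore_det R q 0 1 2.

Definition dehomogenize (R : comNzRingType) (F : {mpoly R[3]}) : {mpoly R[2]} :=
  comp_mpoly [tuple ('X_ord0 : {mpoly R[2]}); 'X_ord_max; 1] F.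

Section FunctionField.
Variables (K L : fieldType) (iota : {rmorphism K -> L}).

Definition eval2 (x y : L) (G : {mpoly K[2]}) : L :=
  mmap iota (tnth [tuple x; y]) G.

(* L is the field of fractions of K[X, Y] / (F(X, Y, 1)), with x and y the
   classes of X and Y. *)
Record function_field (F : {mpoly K[3]}) (x y : L) : Prop := FunctionField {
  function_field_ker : forall G : {mpoly K[2]},
    eval2 x y G = 0 <-> exists H : {mpoly K[2]}, G = H * dehomogenize F;
  function_field_gen : forall f : L, exists G H : {mpoly K[2]},
    eval2 x y H != 0 /\ f = eval2 x y G / eval2 x y H
}.

(* Over an algebraically closed K, a place of L / K is the same thing as a
   normalized discrete valuation of L, trivial on K.  The value v 0 is
   unspecified. *)
Record place (v : L -> int) : Prop := Place {
  place_const : forall c : K, c != 0 -> v (iota c) = 0;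
  placeM : forall f g : L, f != 0 -> g != 0 -> v (f * g) = v f + v g;
  placeD : forall f g : L, f != 0 -> g != 0 -> f + g != 0 ->
    Num.min (v f) (v g) <= v (f + g);
  place_uniformizer : exists2 t : L, t != 0 & v t = 1
}.

Definition vanishes_at (v : L -> int) (f : L) : Prop := f = 0 \/ 0 < v f.

(* P = (P_0 : P_1 : P_2) is the center of the branch given by v and by the
   generic point (x : y : 1): after rescaling by some t, the homogeneous
   coordinates of the generic point specialize to those of P. *)
Definition center (x y : L) (v : L -> int) (P : 'rV[K]_3) : Prop :=
  exists2 t : L, t != 0 &
    forall i : 'I_3,
      vanishes_at v (t * tnth [tuple x; y; 1] i - iota (P 0 i)).

(* The multiplicity, at the branch given by v, of the intersection divisor of
   the curve with the line a x + b y + c z = 0. *)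
Definition line_mult (x y : L) (v : L -> int) (a b c : K) : int :=
  v (iota a * x + iota b * y + iota c)
    - Num.min (v x) (Num.min (v y) (v 1)).

(* D i is the i-th Hasse derivative with respect to the separating
   variable x.  Separability of L / K(x) makes D unique; [hasse0] is needed,
   since the other conditions would allow D 0 to be any automorphism of
   L / K(x). *)
Record hasse_derivatives (x : L) (D : nat -> L -> L) : Prop :=
  HasseDerivatives {
  hasse0 : forall f : L, D 0%N f = f;
  hasseD : forall (i : nat) (f g : L), D i (f + g) = D i f + D i g;
  hasseZ : forall (i : nat) (c : K) (f : L), D i (iota c * f) = iota c * D i f;
  hasseM : forall (i : nat) (f g : L),
    D i (f * g) = \sum_(j < i.+1) D j f * D (i - j)%N g;
  hasseX : forall i m : nat, D i (x ^+ m) = 'C(m, i)%:R * x ^+ (m - i)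
}.

Record derivation (d : L -> L) : Prop := Derivation {
  derivationD : forall f g : L, d (f + g) = d f + d g;
  derivation_const : forall c : K, d (iota c) = 0;
  derivationM : forall f g : L, d (f * g) = d f * g + f * d g
}.

(* The differential df is nonzero and has order n at v: the order of df / dt
   for every local parameter t, where d / dt is the K-derivation d of L
   such that d t = 1. *)
Definition diff_order (v : L -> int) (f : L) (n : int) : Prop :=
  forall t : L, t != 0 -> v t = 1 ->
    exists d : L -> L, [/\ derivation d, d t = 1, d f != 0 & v (d f) = n].

Definition W_S (q : nat) (D : nat -> L -> L) (x y : L) : L :=
  \det (\matrix_(i < 3, j < 3)
          tnth (tnth [tuple [tuple x ^+ q; y ^+ q; 1];
                            [tuple x;      y;      1];
                            [tuple D q x;  D q y;  0]] i) j).

(* m is the coefficient at v of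
   S = div(W_S) + q div(dx) + (q + 2) V, V being cut out by the line z = 0. *)
Definition SV_coef (q : nat) (D : nat -> L -> L) (x y : L) (v : L -> int)
    (m : int) : Prop :=
  W_S q D x y != 0 /\
  exists2 n : int, diff_order v x n &
    m = v (W_S q D x y) + q%:Z * n + (q + 2)%:Z * line_mult x y v 0 0 1.

End FunctionField.

Definition on_curve (K : fieldType) (F : {mpoly K[3]}) (P : 'rV[K]_3) : Prop :=
  P != 0 /\ F.@[fun i => P 0 i] = 0.

(* The point of PG(2, K) represented by P lies in PG(2, F_Q), where
   F_Q = {a | a ^ Q = a}. *)
Definition rational_over (K : fieldType) (Q : nat) (P : 'rV[K]_3) : Prop :=
  exists2 c : K, c != 0 & forall i : 'I_3, (c * P 0 i) ^+ Q = c * P 0 i.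

(* Main.v *)
Require Import Defs.
From HB Require Import structures.
From mathcomp Require Import all_boot all_order all_algebra all_field.
From mathcomp Require Import mpoly.
From mathcomp Require Import ring zify.

Set Implicit Arguments.
Unset Strict Implicit.
Unset Printing Implicit Defensive.

Import Order.TTheory GRing.Theory Num.Theory.
Local Open Scope ring_scope.

(* Put r = x^q - x and s = y^q - y. In affine coordinates D1 = 0 reads
   r (s^q + s^(q^2)) = s (r^q + r^(q^2)), and D2 = r s^q - s r^q. Applying D^(1) and
   D^(q) to D1 = 0 gives D^(1) y = s / r and
     W_S = - (x^(q^3) - x) D2 / (r^q (x^(q^2) - x)^q).
   If the center P has D2(P) <> 0, it is an affine nonsingular point at which
   x - x(P) is a local parameter and only x^(q^3) - x can vanish, to order one, exactly
   when P is F_(q^3)-rational. If D2(P) = 0, then P is on an F_q-line l = 0 but is not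
   F_q-rational, since near an F_q-rational point D1 is D2 times a unit. In suitable
   coordinates the curve is then a cusp l^(q-1) ~ u^q with local parameter l / u; this
   gives the orders of all factors, P is F_(q^2)-rational but not F_(q^3)-rational, and
   the coefficient is 0 in each of the three positions of P relative to the
   coordinates. *)

(** * Orders at a place *)

(** The place [v] is known only through its axioms, so neither local parameters nor the order of dx
    can be read off from power series. The substitute is algebraic. Suppose that [t] and [u] have
    positive order, that every function is a quotient of elements of the local ring they generate,
    and that the equation of the curve takes the form [u * M = t * N] with [M] a unit at the center
    and [N] regular. Then every nonzero function is a power of [t] times a unit; since [v] takes the
    value 1, this forces [v t = 1]. The same description compares ds with dt for every other local
    parameter s. The formula for W_S rests on the tangent slope m = s / r: the tangent line at (x,
    y) passes through (x^q, y^q), and both D2 and D^(q) y turn out to be multiples of m^q - m. *)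

Section Valuation.
Variables (K L : fieldType) (iota : {rmorphism K -> L}) (v : L -> int).
Hypothesis v_place : place iota v.

(* The value v 0 being unspecified, both predicates treat it as +oo. *)
Definition order_ge (n : int) (f : L) : Prop := f = 0 \/ n <= v f.
Definition order_eq (n : int) (f : L) : Prop := f != 0 /\ v f = n.

Lemma order_eq1 : order_eq 0 1.
Proof.
split; first exact: oner_neq0.
by have := place_const v_place (oner_neq0 K); rewrite rmorph1.
Qed.

Lemma order_eq_const c : c != 0 -> order_eq 0 (iota c).
Proof. by move=> c0; split; [rewrite fmorph_eq0 | exact: (place_const v_place)]. Qed.

Lemma order_eqM m n f g : order_eq m f -> order_eq n g -> order_eq (m + n) (f * g).
Proof.
move=> [f0 <-] [g0 <-]; split; first exact: mulf_neq0.
exact: (placeM v_place).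
Qed.

Lemma order_eqV n f : order_eq n f -> order_eq (- n) f^-1.
Proof.
move=> [f0 <-]; split; first by rewrite invr_neq0.
have := placeM v_place f0 (invr_neq0 f0).
by rewrite divff // (proj2 order_eq1); lia.
Qed.

Lemma order_eqX n f (k : nat) : order_eq n f -> order_eq (k%:Z * n) (f ^+ k).
Proof.
move=> fn; elim: k => [|k IHk]; first by rewrite mul0r expr0; exact: order_eq1.
by rewrite exprS intS mulrDl mul1r; exact: order_eqM.
Qed.

Lemma order_ge_eq n f : order_eq n f -> order_ge n f.
Proof. by move=> [_ <-]; right. Qed.

Lemma order_geW m n f : m <= n -> order_ge n f -> order_ge m f.
Proof. by move=> mn [->|nf]; [left | right; exact: le_trans nf]. Qed.

Lemma order_geD n f g : order_ge n f -> order_ge n g -> order_ge n (f + g).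
Proof.
have [->|f0] := eqVneq f 0; first by rewrite add0r.
have [->|g0] := eqVneq g 0; first by rewrite addr0.
have [->|fg0] := eqVneq (f + g) 0; first by left.
move=> [/eqP|nf]; first by rewrite (negPf f0).
move=> [/eqP|ng]; first by rewrite (negPf g0).
by right; apply: le_trans (placeD v_place f0 g0 fg0); rewrite le_min nf.
Qed.

Lemma order_geM m n f g : order_ge m f -> order_ge n g -> order_ge (m + n) (f * g).
Proof.
have [->|f0] := eqVneq f 0; first by rewrite mul0r; left.
have [->|g0] := eqVneq g 0; first by rewrite mulr0; left.
move=> [/eqP|mf]; first by rewrite (negPf f0).
move=> [/eqP|ng]; first by rewrite (negPf g0).
by right; rewrite (placeM v_place) // lerD.
Qed.

Lemma order_ge_const c : order_ge 0 (iota c).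
Proof.
have [->|c0] := eqVneq c 0; first by rewrite rmorph0; left.
exact/order_ge_eq/order_eq_const.
Qed.

Lemma order_geN n f : order_ge n f -> order_ge n (- f).
Proof.
move=> nf; rewrite -mulN1r -[n]add0r; apply: order_geM nf.
by have := order_ge_const (-1); rewrite rmorphN1.
Qed.

Lemma order_geB n f g : order_ge n f -> order_ge n g -> order_ge n (f - g).
Proof. by move=> nf ng; apply: order_geD => //; apply: order_geN. Qed.

Lemma order_geX n f (k : nat) : order_ge n f -> order_ge (k%:Z * n) (f ^+ k).
Proof.
move=> fn; elim: k => [|k IHk].
  by rewrite mul0r expr0; exact/order_ge_eq/order_eq1.
by rewrite exprS intS mulrDl mul1r; exact: order_geM.
Qed.

Lemma order_eqN n f : order_eq n f -> order_eq n (- f).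
Proof.
move=> fn; rewrite -mulN1r -[n]add0r; apply: order_eqM => //.
by have := @order_eq_const (-1); rewrite oppr_eq0 oner_eq0 rmorphN1; apply.
Qed.

Lemma order_eq_inj m n f : order_eq m f -> order_eq n f -> m = n.
Proof. by move=> [_ <-] [_ <-]. Qed.

Lemma order_eq_ge m n f : order_eq m f -> order_ge n f -> n <= m.
Proof. by move=> [f0 <-] [/eqP|//]; rewrite (negPf f0). Qed.

(** A term of strictly smaller order cannot be cancelled. [placeD] bounds the order of a sum only
    from below; the upper bound comes from applying it to f = (f + g) - g. *)
Lemma order_eqD n f g : order_eq n f -> order_ge (n + 1) g -> order_eq n (f + g).
Proof.
move=> fn ng; have gn : order_ge n g by apply: order_geW ng; lia.
have [fg0|fg0] := eqVneq (f + g) 0.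
  have fE : f = - g by apply/eqP; rewrite -addr_eq0 fg0.
  have := order_eq_ge fn (n := n + 1); rewrite {1}fE => /(_ (order_geN ng)); lia.
split=> //; apply/eqP; rewrite eq_le; apply/andP; split; last first.
  have [/eqP|//] : order_ge n (f + g) by apply: order_geD => //; exact: order_ge_eq.
  by rewrite (negPf fg0).
rewrite leNgt; apply/negP => lt_n.
have h : order_ge (n + 1) (f + g) by right; lia.
have := order_eq_ge fn (n := n + 1).
by rewrite -{1}[f](addrK g) => /(_ (order_geB h ng)); lia.
Qed.

Lemma order_eqM_inv n m f g : order_eq n f -> order_eq m (f * g) -> order_eq (m - n) g.
Proof.
move=> [f0 fn] fg; have -> : g = f^-1 * (f * g) by rewrite mulKf.
by rewrite addrC; apply: order_eqM fg; apply: order_eqV.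
Qed.

Lemma order_ge1_const c : order_ge 1 (iota c) -> c = 0.
Proof.
have [//|c0] := eqVneq c 0.
by move/(order_eq_ge (order_eq_const c0)).
Qed.

End Valuation.

(** * Local rings with principal maximal ideal *)

Section Derivation.
Variables (K L : fieldType) (iota : {rmorphism K -> L}) (d : L -> L).
Hypothesis d_der : derivation iota d.

Lemma der0 : d 0 = 0.
Proof. by have := derivation_const d_der 0; rewrite rmorph0. Qed.

Lemma der1 : d 1 = 0.
Proof. by have := derivation_const d_der 1; rewrite rmorph1. Qed.

Lemma derN f : d (- f) = - d f.
Proof.
by apply/eqP; rewrite -subr_eq0 opprK -(derivationD d_der) addNr der0.
Qed.

Lemma derB f g : d (f - g) = d f - d g.
Proof. by rewrite (derivationD d_der) derN. Qed.

Lemma derV f : f != 0 -> d f^-1 = - d f / f ^+ 2.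
Proof.
move=> f0; have : d (f * f^-1) = 0 by rewrite divff // der1.
rewrite (derivationM d_der) => /eqP; rewrite addrC addr_eq0 => /eqP dfV.
apply: (mulfI f0); rewrite dfV; field; exact: f0.
Qed.

Lemma derX f n : d (f ^+ n) = n%:R * f ^+ n.-1 * d f.
Proof.
elim: n => [|n IHn]; first by rewrite expr0 der1 !mul0r.
rewrite exprS (derivationM d_der) IHn; case: n {IHn} => [|n].
  by rewrite expr0; ring.
by rewrite /= exprS -[n.+2%:R]natr1; ring.
Qed.

Lemma derivationZ a : derivation iota (fun f => a * d f).
Proof.
split=> [f g|c|f g].
- by rewrite (derivationD d_der) mulrDr.
- by rewrite (derivation_const d_der) mulr0.
- by rewrite (derivationM d_der); ring.
Qed.

End Derivation.

(** Stated as an induction principle over the field operations, so that a change of generators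
    (shear, swap, chart at infinity) is a matter of closure. *)
Definition generates (K L : fieldType) (iota : {rmorphism K -> L}) (x y : L) :=
  forall P : L -> Prop, (forall c, P (iota c)) ->
    (forall f g, P f -> P g -> P (f + g)) -> (forall f g, P f -> P g -> P (f * g)) ->
    (forall f, P f -> P f^-1) -> P x -> P y -> forall f, P f.

Lemma function_field_generates (K L : fieldType) (iota : {rmorphism K -> L})
  (F : {mpoly K[3]}) (x y : L) : function_field iota F x y -> generates iota x y.
Proof.
move=> ff P Pc PD PM PV Px Py f; have [G [H [_ ->]]] := function_field_gen ff f.
have Peval (A : {mpoly K[2]}) : P (eval2 iota x y A).
  apply: big_ind => [||m _]; [by rewrite -(rmorph0 iota) | exact: PD |].
  apply: (PM) => //; apply: big_ind => [||i _];
    [by rewrite -(rmorph1 iota) | exact: PM |].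
  elim: (m i) => [|k IHk]; first by rewrite expr0 -(rmorph1 iota).
  by rewrite exprS; apply: (PM) => //; case: i {IHk} => -[|[|//]] ?;
    rewrite (tnth_nth 0).
by apply: (PM) => //; apply: PV.
Qed.

Section LocalRing.
Variables (K L : fieldType) (iota : {rmorphism K -> L}) (v : L -> int).
Hypothesis v_place : place iota v.
Variables t u : L.

(** For [t] and [u] of positive order this is the localization of K[t, u] at the origin, realized
    inside [L]. *)
Inductive local_ring : L -> Prop :=
| local_ring_const c : local_ring (iota c)
| local_ring_t : local_ring t
| local_ring_u : local_ring u
| local_ringD f g : local_ring f -> local_ring g -> local_ring (f + g)
| local_ringM f g : local_ring f -> local_ring g -> local_ring (f * g)
| local_ringV f : local_ring f -> order_eq v 0 f -> local_ring f^-1.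

Lemma local_ring1 : local_ring 1.
Proof. by have := local_ring_const 1; rewrite rmorph1. Qed.

Lemma local_ring0 : local_ring 0.
Proof. by have := local_ring_const 0; rewrite rmorph0. Qed.

Lemma local_ringN f : local_ring f -> local_ring (- f).
Proof.
rewrite -mulN1r; apply: local_ringM.
by have := local_ring_const (-1); rewrite rmorphN1.
Qed.

Lemma local_ringB f g : local_ring f -> local_ring g -> local_ring (f - g).
Proof. by move=> rf rg; apply/local_ringD/local_ringN. Qed.

Lemma local_ringX f n : local_ring f -> local_ring (f ^+ n).
Proof.
move=> rf; elim: n => [|n IHn]; first exact: local_ring1.
by rewrite exprS; exact: local_ringM.
Qed.

Hypotheses (t_neq0 : t != 0) (t_gt0 : order_ge v 1 t) (u_gt0 : order_ge v 1 u).

Lemma local_ring_ge0 f : local_ring f -> order_ge v 0 f.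
Proof.
elim=> {f} [c|||f g _ rf _ rg|f g _ rf _ rg|f _ _ f0].
- exact: (order_ge_const v_place).
- exact: order_geW t_gt0.
- exact: order_geW u_gt0.
- exact: (order_geD v_place).
- exact: (order_geM v_place rf rg).
- by apply: order_ge_eq; rewrite -oppr0; exact: (order_eqV v_place).
Qed.

(* The maximal ideal (t, u) is then principal, generated by t. *)
Hypothesis u_in_t : exists2 h, local_ring h & u = t * h.

(** Since [u] is a multiple of [t], reduction modulo [t] leaves only constants: the residue field is
    K. *)
Lemma local_ring_split f : local_ring f ->
  exists c g, local_ring g /\ f = iota c + t * g.
Proof.
elim=> {f} [c|||f g rf [c [f1 [rf1 Ef]]] rg [e [g1 [rg1 Eg]]]
  |f g rf [c [f1 [rf1 Ef]]] rg [e [g1 [rg1 Eg]]]|f rf [c [f1 [rf1 Ef]]] f0].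
- by exists c, 0; split; [exact: local_ring0 | rewrite mulr0 addr0].
- by exists 0, 1; split; [exact: local_ring1 | rewrite rmorph0 add0r mulr1].
- have [h rh uE] := u_in_t.
  by exists 0, h; split; [|rewrite rmorph0 add0r].
- exists (c + e), (f1 + g1); split; first exact: local_ringD.
  by rewrite Ef Eg rmorphD; ring.
- exists (c * e), (iota c * g1 + f1 * g); split.
    by apply: local_ringD; apply: local_ringM => //; exact: local_ring_const.
  by rewrite Ef Eg rmorphM; ring.
(* With a zero constant term, [f] would be a multiple of [t] and have positive order. *)
- have c0 : c != 0.
    apply/eqP => c0; have := order_eq_ge f0 (n := 1).
    rewrite Ef c0 rmorph0 add0r -[X in order_ge v X]addr0 => h.
    by have := h (order_geM v_place t_gt0 (local_ring_ge0 rf1)).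
  (* From f = c + t f1 one gets 1/f = 1/c - t f1 / (c f). *)
  exists c^-1, (- (iota c^-1 * f1 * f^-1)); split.
    apply/local_ringN/local_ringM; last exact: local_ringV.
    by apply: local_ringM => //; exact: local_ring_const.
  have ic0 : iota c != 0 by rewrite fmorph_eq0.
  have fn0 := proj1 f0; have tf1 : t * f1 = f - iota c by rewrite Ef; ring.
  rewrite fmorphV; have -> : t * - ((iota c)^-1 * f1 * f^-1) = - ((t * f1) / (iota c
    * f)).
    by field; rewrite fn0 ic0.
  by rewrite tf1; field; rewrite fn0 ic0.
Qed.

(** Factors [t] are split off as long as the constant term vanishes; each lowers the order by [v t],
    which is positive, so this stops. *)
Lemma local_ring_order f : local_ring f -> f != 0 ->
  exists (m : nat) e, [/\ local_ring e, order_eq v 0 e & f = t ^+ m * e].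
Proof.
have tv : 0 < v t by case: t_gt0 => [/eqP|//]; rewrite (negPf t_neq0).
move=> rf f0; have [n] : exists n : nat, v f < n%:Z by exists `|v f|.+1; lia.
elim: n => [|n IHn] in f rf f0 *.
  by case: (local_ring_ge0 rf) => [/eqP|]; [rewrite (negPf f0) | lia].
have [c [g [rg fE]]] := local_ring_split rf.
have tg : order_ge v 1 (t * g).
  by rewrite -[X in order_ge v X]addr0;
    exact: (order_geM v_place t_gt0 (local_ring_ge0 rg)).
have [c0|c0] := eqVneq c 0; last first.
  move=> _; exists 0, f; split; rewrite ?expr0 ?mul1r // fE.
  by apply: (order_eqD v_place) => //; exact: (order_eq_const v_place).
rewrite c0 rmorph0 add0r in fE.
have g0 : g != 0 by apply: contraNneq f0 => g0; rewrite fE g0 mulr0.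
rewrite fE (placeM v_place) // => lt_n.
have [|m [e [re e0 gE]]] := IHn g rg g0; first lia.
by exists m.+1, e; split=> //; rewrite exprS gE mulrA.
Qed.

Definition local_fraction (f : L) :=
  exists a b, [/\ local_ring a, local_ring b, b != 0 & f = a / b].

Lemma local_fraction_ring f : local_ring f -> local_fraction f.
Proof.
move=> rf; exists f, 1; split; rewrite ?divr1 ?oner_neq0 //; exact: local_ring1.
Qed.

Lemma local_fractionD f g :
  local_fraction f -> local_fraction g -> local_fraction (f + g).
Proof.
move=> [a [b [ra rb b0 ->]]] [a' [b' [ra' rb' b'0 ->]]].
exists (a * b' + a' * b), (b * b'); split.
- by apply: local_ringD; exact: local_ringM.
- exact: local_ringM.
- exact: mulf_neq0.
- by field; rewrite ?b0 ?b'0.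
Qed.

Lemma local_fractionM f g :
  local_fraction f -> local_fraction g -> local_fraction (f * g).
Proof.
move=> [a [b [ra rb b0 ->]]] [a' [b' [ra' rb' b'0 ->]]].
exists (a * a'), (b * b'); split; try exact: local_ringM.
- exact: mulf_neq0.
- by field; rewrite ?b0 ?b'0.
Qed.

Lemma local_fractionV f : local_fraction f -> local_fraction f^-1.
Proof.
move=> [a [b [ra rb b0 ->]]]; have [->|a0] := eqVneq a 0.
  by rewrite mul0r invr0; apply/local_fraction_ring/local_ring0.
by exists b, a; rewrite invf_div.
Qed.

Lemma local_fraction_generates x y : generates iota x y ->
  local_fraction x -> local_fraction y -> forall f, local_fraction f.
Proof.
move=> gen; apply: gen => [c|f g|f g|f].
- exact/local_fraction_ring/local_ring_const.
- exact: local_fractionD.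
- exact: local_fractionM.
- exact: local_fractionV.
Qed.

Hypothesis local_fractionT : forall f, local_fraction f.

Lemma local_fraction_order f : f != 0 -> exists (m n : nat) e e',
  [/\ local_ring e, local_ring e', order_eq v 0 e, order_eq v 0 e' &
      t ^+ n * e' * f = t ^+ m * e].
Proof.
have [a [b [ra rb b0 ->]]] := local_fractionT f => f0.
have a0 : a != 0 by apply: contraNneq f0 => ->; rewrite mul0r.
have [m [e [re e0 aE]]] := local_ring_order ra a0.
have [n [e' [re' e'0 bE]]] := local_ring_order rb b0.
by exists m, n, e, e'; split=> //; rewrite -aE -bE mulrC divfK.
Qed.

(** Some s has order 1, and s is a power of [t] up to units, so [v t] divides 1. *)
Lemma local_uniformizer : order_eq v 1 t.
Proof.
have tv : 0 < v t by case: t_gt0 => [/eqP|//]; rewrite (negPf t_neq0).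
split=> //; have [s s0 vs] := place_uniformizer v_place.
have [m [n [e [e' [_ _ e0 e'0 E]]]]] := local_fraction_order s0.
have tt : order_eq v (v t) t by [].
have h1 := order_eqM v_place (order_eqM v_place (order_eqX v_place n tt) e'0) (conj
  s0 vs).
have h2 := order_eqM v_place (order_eqX v_place m tt) e0.
rewrite E in h1; have := order_eq_inj h1 h2; rewrite !addr0 => Ev.
have : (m%:Z - n%:Z) * v t = 1 by rewrite mulrBl -Ev; ring.
move=> E1; have : (v t %| 1)%Z by apply/dvdzP; exists (m%:Z - n%:Z).
by rewrite dvdz1 => /eqP; lia.
Qed.

Lemma local_ring_der (d : L -> L) : derivation iota d -> d t = 1 ->
  order_ge v 0 (d u) -> forall f, local_ring f -> order_ge v 0 (d f).
Proof.
move=> d_der dt du f; elim=> {f} [c|||f g _ df _ dg|f g rf df rg dg|f _ df f0].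
- by rewrite (derivation_const d_der); left.
- by rewrite dt; exact/order_ge_eq/(order_eq1 v_place).
- exact: du.
- by rewrite (derivationD d_der); exact: (order_geD v_place).
- rewrite (derivationM d_der); apply: (order_geD v_place).
    exact: (order_geM v_place df (local_ring_ge0 rg)).
  exact: (order_geM v_place (local_ring_ge0 rf) dg).
- rewrite (derV d_der) ?(proj1 f0) // mulNr; apply: (order_geN v_place).
  apply: (order_geM v_place df (n := 0)); apply: order_ge_eq.
  have := order_eqV v_place (order_eqX v_place 2 f0); by rewrite mulr0 oppr0.
Qed.

(** Another local parameter is [t] times a unit, and d/dt keeps regular functions regular, so ds/dt
    is a unit. This serves [diff_order], which quantifies over all local parameters. *)
Lemma local_uniformizer_der (d : L -> L) s : derivation iota d ->
  d t != 0 -> order_ge v 0 (d u / d t) -> order_eq v 1 s ->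
  d s != 0 /\ v (d s) = v (d t).
Proof.
move=> d_der dt0 du s1.
have := derivationZ d_der (d t)^-1; set D := fun f => _ => D_der.
have Dt : D t = 1 by rewrite /D mulVf.
have Du : order_ge v 0 (D u) by rewrite /D mulrC.
have Dr := local_ring_der D_der Dt Du.
have [m [n [e [e' [re re' e0 e'0 E]]]]] := local_fraction_order (proj1 s1).
have t1 := local_uniformizer.
have mE : m = n.+1.
  have h1 := order_eqM v_place (order_eqM v_place (order_eqX v_place n t1) e'0) s1.
  have h2 := order_eqM v_place (order_eqX v_place m t1) e0.
  by rewrite E in h1; have := order_eq_inj h1 h2; lia.
have sE : e' * s = t * e.
  by apply: (mulfI (expf_neq0 n t_neq0)); rewrite mulrA E mE exprS; ring.
(* Derivative of [e' * s = t * e]; the terms in parentheses have positive order. *)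
have : e' * D s = e + (t * D e - D e' * s).
  apply: (addrI (D e' * s)); rewrite -(derivationM D_der) sE (derivationM D_der) Dt.
  by ring.
have : order_eq v 0 (e + (t * D e - D e' * s)).
  apply: (order_eqD v_place e0); apply: (order_geB v_place).
    exact: (order_geM v_place t_gt0 (Dr e re)).
  exact: (order_geM v_place (Dr e' re') (order_ge_eq s1)).
move=> /[swap] <- /(order_eqM_inv v_place e'0); rewrite subr0 => Ds.
have := order_eqM v_place (conj dt0 erefl) Ds.
by rewrite mulrA divff // mul1r addr0 => -[].
Qed.

End LocalRing.

(** * Hasse derivatives of q-th powers *)

Section Frobenius.
Variables (R : comNzRingType) (q : nat).
Hypothesis q_pchar : [pchar R].-nat q.

Lemma frobD (f g : R) : (f + g) ^+ q = f ^+ q + g ^+ q.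
Proof. exact: exprDn_pchar. Qed.

Lemma frobN (f : R) : (- f) ^+ q = - f ^+ q.
Proof.
have q0 : (0 < q)%N by case/andP: q_pchar.
by apply/eqP; rewrite -addr_eq0 -frobD addNr expr0n eqn0Ngt q0.
Qed.

Lemma frobB (f g : R) : (f - g) ^+ q = f ^+ q - g ^+ q.
Proof. by rewrite frobD frobN. Qed.

Lemma frob_natr : (1 < q)%N -> q%:R = 0 :> R.
Proof.
move=> q1; have pr := pdiv_prime q1.
have /(pnatP _ (ltnW q1)) /(_ _ pr (pdiv_dvd q)) pq := q_pchar.
by apply/eqP; rewrite -(dvdn_pcharf pq) pdiv_dvd.
Qed.

End Frobenius.

Section Hasse.
Variables (K L : fieldType) (iota : {rmorphism K -> L}) (q : nat).
Hypotheses (q_pchar : [pchar L].-nat q) (q_gt1 : (1 < q)%N).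
Variables (x y : L) (D : nat -> L -> L).
Hypothesis D_hasse : hasse_derivatives iota x D.

Lemma hasse_derivation : derivation iota (D 1).
Proof.
have D1 : D 1%N 1 = 0.
  by have := hasseX D_hasse 1 0; rewrite expr0 => ->; rewrite mul0r.
split=> [f g|c|f g].
- exact: (hasseD D_hasse).
- by have := hasseZ D_hasse 1 c 1; rewrite mulr1 D1 mulr0.
- rewrite (hasseM D_hasse) !big_ord_recl big_ord0 /= !(hasse0 D_hasse).
  by rewrite addr0 addrC.
Qed.

Lemma hasse1X : D 1 x = 1.
Proof.
by have := hasseX D_hasse 1 1; rewrite expr1 => ->; rewrite subnn expr0 mulr1.
Qed.

Lemma hasseX0 i : (1 < i)%N -> D i x = 0.
Proof.
move=> i1; have := hasseX D_hasse i 1; rewrite expr1 => ->.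
by rewrite bin_small // mul0r.
Qed.

(* f |-> \sum_i D i f 'X^i is multiplicative, by the Leibniz rule hasseM. *)
Lemma hasse_exp N f k i : (i < N)%N ->
  ((\poly_(j < N) D j f) ^+ k)`_i = D i (f ^+ k).
Proof.
elim: k i => [|k IHk] i iN.
  by rewrite !expr0 coef1 -[1 in RHS](expr0 x) (hasseX D_hasse) bin0n;
    case: i {iN} => [|i]; rewrite ?mul1r ?mul0r.
rewrite !exprS coefM (hasseM D_hasse); apply: eq_bigr => j _.
rewrite coef_poly (leq_ltn_trans (ltn_ord j : (j <= i)%N) iN).
by rewrite IHk // (leq_ltn_trans _ iN) // leq_subr.
Qed.

(** In characteristic p the q-th power of f + X g is f^q + X^q g^q. Hence the Hasse derivatives of
    f^q vanish in degrees strictly between 0 and q, and the one of degree q is (D^(1) f)^q. *)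
Lemma hasse_poly_frob f : (\poly_(j < q.+1) D j f) ^+ q =
  (f ^+ q)%:P + 'X^q * (\poly_(j < q) D j.+1 f) ^+ q.
Proof.
have qP : [pchar {poly L}].-nat q by rewrite (eq_pnat _ (@pchar_poly L)).
have -> : \poly_(j < q.+1) D j f = f%:P + 'X * \poly_(j < q) D j.+1 f.
  apply/polyP => i; rewrite coefD coefXM !coef_poly coefC.
  by case: i => [|i]; rewrite /= ?(hasse0 D_hasse) ?addr0 ?add0r.
by rewrite (frobD qP) exprMn rmorphXn.
Qed.

Lemma hasse_frob0 f i : (0 < i < q)%N -> D i (f ^+ q) = 0.
Proof.
case/andP=> i0 iq; rewrite -(@hasse_exp q.+1); last by rewrite ltnS ltnW.
by rewrite hasse_poly_frob coefD coefC coefXnM iq addr0 eqn0Ngt i0.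
Qed.

Lemma hasse_frob f : D q (f ^+ q) = D 1 f ^+ q.
Proof.
have q0 := ltnW q_gt1; rewrite -(@hasse_exp q.+1) // hasse_poly_frob.
rewrite coefD coefC eqn0Ngt q0 add0r coefXnM ltnn subnn.
by rewrite -horner_coef0 horner_exp horner_coef0 coef_poly q0.
Qed.

(** Because of these gaps only the two extreme terms of the Leibniz sum survive. *)
Lemma hasseM_frob f g : D q (f * g ^+ q) = D q f * g ^+ q + f * D 1 g ^+ q.
Proof.
rewrite (hasseM D_hasse) big_ord_recr /= subnn (hasse0 D_hasse) addrC; congr (_ + _).
case: q q_gt1 (@hasse_frob g) (@hasse_frob0 g) => // q' q1 hq h0.
rewrite big_ord_recl /= (hasse0 D_hasse) subn0 hq big1 ?addr0 // => i _.
rewrite h0 ?mulr0 // /bump /= add1n subSS subn_gt0 ltn_ord /=.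
by rewrite ltnS leq_subr.
Qed.

Lemma der_frob (d : L -> L) f : derivation iota d -> d (f ^+ q) = 0.
Proof. by move=> d_der; rewrite (derX d_der) (frob_natr q_pchar) // !mul0r. Qed.

End Hasse.

(** * The affine equation of the curve *)

Lemma det_mx33 (R : comNzRingType) (M : 'M[R]_3) :
  let a i j := M (inord i) (inord j) in
  \det M = a 0%N 0%N * (a 1%N 1%N * a 2%N 2%N - a 1%N 2%N * a 2%N 1%N)
    - a 0%N 1%N * (a 1%N 0%N * a 2%N 2%N - a 1%N 2%N * a 2%N 0%N)
    + a 0%N 2%N * (a 1%N 0%N * a 2%N 1%N - a 1%N 1%N * a 2%N 0%N).
Proof.
move=> a; have -> : M = \matrix_(i, j) a i j.
  by apply/matrixP => i j; rewrite mxE /a !inord_val.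
do 2! rewrite !(expand_det_row _ ord0) !big_ord_recl !big_ord0 /cofactor.
by rewrite !det_mx11 !mxE /= /bump /= !(add0n, addn0) !expr0 !expr1; ring.
Qed.

Section Moore.
Variables (R : comNzRingType) (q : nat).

Definition affine_D1 (x y : R) :=
  (x ^+ q - x) * (((y ^+ q) ^+ q) ^+ q - y ^+ q)
  - (y ^+ q - y) * (((x ^+ q) ^+ q) ^+ q - x ^+ q).

Definition affine_D2 (x y : R) :=
  (x ^+ q - x) * ((y ^+ q) ^+ q - y ^+ q)
  - (y ^+ q - y) * ((x ^+ q) ^+ q - x ^+ q).

Lemma det_affine (x y : R) (a b c : nat) :
  \det (\matrix_(i < 3, j < 3)
     tnth [tuple x; y; 1] i ^+ (q ^ tnth [tuple a; b; c] j)%N) =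
  (x ^+ (q ^ b) - x ^+ (q ^ a)) * (y ^+ (q ^ c) - y ^+ (q ^ b))
  - (y ^+ (q ^ b) - y ^+ (q ^ a)) * (x ^+ (q ^ c) - x ^+ (q ^ b)).
Proof.
rewrite det_mx33 /= !mxE !(tnth_nth 0) !inordK //= !expr1n.
by ring.
Qed.

Lemma rmorph_moore_det (K : comNzRingType) (f : {rmorphism {mpoly K[3]} -> R})
  (x y : R) (a b c : nat) : (forall i, f 'X_i = tnth [tuple x; y; 1] i) ->
  f (moore_det K q a b c) =
  (x ^+ (q ^ b) - x ^+ (q ^ a)) * (y ^+ (q ^ c) - y ^+ (q ^ b))
  - (y ^+ (q ^ b) - y ^+ (q ^ a)) * (x ^+ (q ^ c) - x ^+ (q ^ b)).
Proof.
move=> fX; rewrite /moore_det -det_map_mx -det_affine; congr (\det _).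
by apply/matrixP => i j; rewrite !mxE rmorphXn fX.
Qed.

Lemma rmorph_D1 (K : comNzRingType) (f : {rmorphism {mpoly K[3]} -> R}) (x y : R) :
  (forall i, f 'X_i = tnth [tuple x; y; 1] i) -> f (D1 K q) = affine_D1 x y.
Proof.
move=> fX; rewrite /D1 (rmorph_moore_det _ _ _ fX) /affine_D1.
by rewrite !expn0 !expr1 !expn1 !expnS !expn0 !muln1 !exprM.
Qed.

Lemma rmorph_D2 (K : comNzRingType) (f : {rmorphism {mpoly K[3]} -> R}) (x y : R) :
  (forall i, f 'X_i = tnth [tuple x; y; 1] i) -> f (D2 K q) = affine_D2 x y.
Proof.
move=> fX; rewrite /D2 (rmorph_moore_det _ _ _ fX) /affine_D2.
by rewrite !expn0 !expr1 !expn1 !expnS !expn0 !muln1 !exprM.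
Qed.

End Moore.

Section FunctionField.
Variables (K L : fieldType) (iota : {rmorphism K -> L}) (q : nat).
Variables (F : {mpoly K[3]}) (x y : L).
Hypotheses (def_F : F * D2 K q = D1 K q) (L_ff : function_field iota F x y).

Let dehom_rm : {rmorphism {mpoly K[3]} -> {mpoly K[2]}} :=
  comp_mpoly [tuple ('X_ord0 : {mpoly K[2]}); 'X_ord_max; 1].
Let eval_rm : {rmorphism {mpoly K[2]} -> L} := mmap iota (tnth [tuple x; y]).

Let dehomX i : dehom_rm 'X_i = tnth [tuple 'X_ord0; 'X_ord_max; 1] i.
Proof. by rewrite /dehom_rm /= comp_mpolyXU (tnth_nth 0). Qed.

Let evalX i : (eval_rm \o dehom_rm) 'X_i = tnth [tuple x; y; 1] i.
Proof.
rewrite /= -/dehom_rm dehomX; case: i => -[|[|[|//]]] ?; rewrite !(tnth_nth 0) /=.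
- by rewrite mmapX mmap1U (tnth_nth 0).
- by rewrite mmapX mmap1U (tnth_nth 0).
- by rewrite rmorph1.
Qed.

Lemma ff_affine_D1 : affine_D1 q x y = 0.
Proof.
rewrite -(rmorph_D1 q evalX) -def_F rmorphM /=.
have -> : mmap iota (tnth [tuple x; y]) (dehomogenize F) = 0.
  by apply/(function_field_ker L_ff); exists 1; rewrite mul1r.
by rewrite mul0r.
Qed.

(** If D2 vanished in [L], F(X, Y, 1) would divide D2(X, Y, 1). At (a, b), D1 = 0 with D2 <> 0
    forces F = 0, and divisibility would then give D2 = 0. *)
Lemma ff_affine_D2 (a b : K) : affine_D1 q a b = 0 -> affine_D2 q a b != 0 ->
  affine_D2 q x y != 0.
Proof.
move=> d1 d2; apply/eqP; rewrite -(rmorph_D2 q evalX) /=.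
move/(function_field_ker L_ff) => [G EG].
pose at_ab : {rmorphism {mpoly K[2]} -> K} := meval (tnth [tuple a; b]).
have at_abX i : (at_ab \o dehom_rm) 'X_i = tnth [tuple a; b; 1] i.
  rewrite /= -/dehom_rm dehomX; case: i => -[|[|[|//]]] ?; rewrite !(tnth_nth 0) /=.
  - by rewrite mevalXU (tnth_nth 0).
  - by rewrite mevalXU (tnth_nth 0).
  - by rewrite rmorph1.
move: d1 d2; rewrite -(rmorph_D1 q at_abX) -(rmorph_D2 q at_abX) -def_F rmorphM.
move/eqP; rewrite mulf_eq0 => /orP[/eqP F0|/eqP-> /eqP//].
move=> /eqP; apply; transitivity (at_ab (G * dehomogenize F)).
  by rewrite -EG.
rewrite rmorphM.
by rewrite [X in _ * X](F0 : at_ab (dehomogenize F) = 0) mulr0.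
Qed.

End FunctionField.

(** * A point with D1 = 0 and D2 <> 0 *)

Lemma closed_XnD_root (K : closedFieldType) (n : nat) (r : {poly K}) :
  (0 < n)%N -> (size r <= n)%N -> exists a, a ^+ n + r.[a] = 0.
Proof.
move=> n0 rn; have : size ('X^n + r) != 1%N.
  by rewrite size_polyDl size_polyXn ?ltnS // eqSS -lt0n.
by move/closed_rootP => [a /rootP]; rewrite hornerD hornerXn; exists a.
Qed.

(* The point is (a, a^2) with a in F_(q^3) but not in F_q. *)
Lemma exists_affine_point (K : closedFieldType) (q : nat) :
  [pchar K].-nat q -> (1 < q)%N ->
  exists a b : K, affine_D1 q a b = 0 /\ affine_D2 q a b != 0.
Proof.
move=> qK q1; have q0 := ltnW q1.
have qq : (q + q <= q * q)%N by rewrite addnn -mul2n leq_mul2r q1 orbT.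
(* [e] is to be a^q - a. For a^(q^3) = a its trace e + e^q + e^(q^2) has to vanish; dividing by e
   gives this equation, whose constant term 1 excludes e = 0. *)
have [||e eE] := @closed_XnD_root K (q * q).-1 ('X^(q.-1) + 1).
- by lia.
- by rewrite size_polyDl size_polyXn ?size_poly1; lia.
rewrite !hornerE in eE.
have e0 : e != 0.
  apply: contra_eq_neq eE => ->; rewrite !expr0n.
  have -> : ((q * q).-1 == 0)%N = false by lia.
  have -> : (q.-1 == 0)%N = false by lia.
  by rewrite /= !add0r oner_neq0.
(* Now a solves a^q = a + e. *)
have [|a aE] := @closed_XnD_root K q (- ('X + e%:P)) q0.
  by rewrite size_polyN size_XaddC.
rewrite !hornerE in aE.
have bE : a ^+ q = a + e by apply/eqP; rewrite -subr_eq0 aE.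
have cE : (a ^+ q) ^+ q = a ^+ q + e ^+ q by rewrite {1}bE (frobD qK).
have dE : ((a ^+ q) ^+ q) ^+ q = a.
  rewrite cE bE !(frobD qK) bE -[RHS]addr0 -(mulr0 e) -eE !mulrDr mulr1 -!exprS.
  by rewrite !prednK ?muln_gt0 ?q0 // exprM; ring.
have ba : a ^+ q - a != 0 by rewrite bE addrC addKr.
have cb : (a ^+ q) ^+ q - a ^+ q != 0 by rewrite -(frobB qK) expf_neq0.
have ca : (a ^+ q) ^+ q - a != 0.
  apply: contra ba => /eqP/subr0_eq ca; by rewrite -{1}ca dE subrr.
exists a, (a ^+ 2); rewrite /affine_D1 /affine_D2.
rewrite !exprMn dE.
(* Vandermonde determinant of a, a^q, a^(q^2). *)
have -> : (a ^+ q - a) * ((a ^+ q) ^+ q * (a ^+ q) ^+ q - a ^+ q * a ^+ q) -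
 (a ^+ q * a ^+ q - a * a) * ((a ^+ q) ^+ q - a ^+ q) =
 (a ^+ q - a) * ((a ^+ q) ^+ q - a ^+ q) * ((a ^+ q) ^+ q - a) by ring.
by split; [ring | rewrite !mulf_neq0].
Qed.

(** * The function W_S *)

Lemma W_S_expand (L : fieldType) (q : nat) (D : nat -> L -> L) (x y : L) :
  D q x = 0 -> W_S q D x y = (x - x ^+ q) * D q y.
Proof.
move=> Dx; rewrite /W_S det_mx33 /= !mxE !(tnth_nth [tuple 0; 0; 0]) !inordK //=.
by rewrite !(tnth_nth 0) !inordK //= Dx; ring.
Qed.

Section TangentLine.
Variables (K L : fieldType) (iota : {rmorphism K -> L}) (q : nat).
Hypotheses (q_pchar : [pchar L].-nat q) (q_gt1 : (1 < q)%N).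

(** Derivations kill q-th powers, so only the linear occurrences of x and y in D1 contribute. *)
Lemma der_affine_D1 (d : L -> L) (x y : L) :
  derivation iota d -> affine_D1 q x y = 0 ->
  d x * (((y ^+ q) ^+ q) ^+ q - y ^+ q) = d y * (((x ^+ q) ^+ q) ^+ q - x ^+ q).
Proof.
move=> d_der /(congr1 d); rewrite (der0 d_der) /affine_D1 (derB d_der).
rewrite !(derivationM d_der) !(derB d_der) !(der_frob q_pchar q_gt1 _ d_der) => E.
by apply/eqP; rewrite -subr_eq0 -oppr_eq0 -[X in _ == X]E; apply/eqP; ring.
Qed.

Lemma der_frob_neq (d : L -> L) (x : L) n : derivation iota d -> d x != 0 ->
  (q %| n)%N -> x ^+ n != x.
Proof.
move=> d_der dx0 /dvdnP[k ->]; apply: contraNneq dx0 => <-.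
by rewrite exprM (der_frob q_pchar q_gt1 _ d_der).
Qed.

Variables (x y : L) (D : nat -> L -> L).
Hypotheses (D_hasse : hasse_derivatives iota x D) (xy_D1 : affine_D1 q x y = 0).

Let D_der := hasse_derivation D_hasse.

Lemma hasse_frob_neq n : (q %| n)%N -> x ^+ n != x.
Proof. by apply: der_frob_neq D_der _; rewrite (hasse1X D_hasse) oner_neq0. Qed.

Lemma hasse_affine_D1 :
  (((x ^+ q) ^+ q) ^+ q - x ^+ q) * D q y =
  y - ((y ^+ q) ^+ q) ^+ q + (((x ^+ q) ^+ q) ^+ q - x) * D 1 y ^+ q.
Proof.
pose y2 := (y ^+ q) ^+ q; pose x2 := (x ^+ q) ^+ q.
(* Expansion of the determinant along its first column: D1 is linear in x and y with q-th powers as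
   coefficients, the form that [hasseM_frob] handles. *)
have E : x * (y - y2) ^+ q + y * (x2 - x) ^+ q + 1 * (x * y2 - x2 * y) ^+ q = 0.
  rewrite -[RHS]xy_D1 /affine_D1 !(frobB q_pchar) !exprMn /x2 /y2; ring.
have := congr1 (D q) E; rewrite !(hasseD D_hasse) !(hasseM_frob q_pchar q_gt1 D_hasse).
rewrite !(derB D_der) !(derivationM D_der) !(der_frob q_pchar q_gt1 _ D_der).
have D0 : D q 0 = 0 by have := hasseZ D_hasse q 0 0; rewrite rmorph0 !mul0r.
have D1 : D q 1 = 0.
  by have := hasseX D_hasse q 0; rewrite expr0 bin_small ?mul0r // ltnW.
rewrite D0 D1 (hasseX0 D_hasse) // (hasse1X D_hasse) !(mul0r, add0r, addr0, mul1r,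
  subr0, sub0r, mulr0).
rewrite !(frobN q_pchar) !(frobB q_pchar) !exprMn expr1n -/x2 -/y2 => E'.
by apply/eqP; rewrite -subr_eq0 -[X in _ == X]E'; apply/eqP; ring.
Qed.

(** Let m = D^(1) y. Then s = m r gives D2 = r^(q+1) (m^q - m), and [hasse_affine_D1] becomes
    (x^(q^3) - x^q) D^(q) y = (x^(q^3) - x) (m^q - m). Eliminating m^q - m yields the formula. *)
Lemma W_S_formula :
  W_S q D x y * (x ^+ q - x) ^+ q * ((x ^+ q) ^+ q - x) ^+ q =
  - ((((x ^+ q) ^+ q) ^+ q - x) * affine_D2 q x y).
Proof.
rewrite W_S_expand ?(hasseX0 D_hasse) //.
have x10 : x ^+ q - x != 0 by rewrite subr_eq0 hasse_frob_neq.
have x30 : ((x ^+ q) ^+ q) ^+ q - x ^+ q != 0.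
  by rewrite -(frobB q_pchar) expf_neq0 // subr_eq0 -exprM hasse_frob_neq // dvdn_mulr.
have := der_affine_D1 D_der xy_D1; rewrite (hasse1X D_hasse) mul1r => yE.
have rE : (x ^+ q - x) * D 1 y = y ^+ q - y.
  apply: (mulIf x30); move/eqP: xy_D1; rewrite /affine_D1 subr_eq0 => /eqP <-.
  by rewrite yE; ring.
have rqE := congr1 (fun f => f ^+ q) rE; rewrite exprMn !(frobB q_pchar) in rqE.
have hE := hasse_affine_D1.
have -> : (x - x ^+ q) * D q y * (x ^+ q - x) ^+ q * ((x ^+ q) ^+ q - x) ^+ q =
   - ((x ^+ q - x) * ((x ^+ q) ^+ q - x ^+ q) *
      ((((x ^+ q) ^+ q) ^+ q - x ^+ q) * D q y)).
  by rewrite !(frobB q_pchar); ring.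
rewrite hE; congr (- _); rewrite /affine_D2 -rqE -rE.
(* The tangent line at (x, y) contains (x^q, y^q) and (x^(q^3), y^(q^3)), so y^(q^3) - y = m
   (x^(q^3) - x). *)
have -> : y - ((y ^+ q) ^+ q) ^+ q = - (((x ^+ q) ^+ q) ^+ q - x) * D 1 y.
  by apply/eqP; rewrite -subr_eq0; apply/eqP;
    transitivity (- ((((y ^+ q) ^+ q) ^+ q - y ^+ q) - D 1 y * (((x ^+ q) ^+ q) ^+ q
      - x ^+ q)
      + ((y ^+ q - y) - (x ^+ q - x) * D 1 y))); [ring | rewrite yE rE; ring].
ring.
Qed.

End TangentLine.

(** * Residues *)

Section Residue.
Variables (K L : fieldType) (iota : {rmorphism K -> L}) (v : L -> int).
Hypothesis v_place : place iota v.

Definition residue (f : L) (a : K) : Prop := order_ge v 1 (f - iota a).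

Lemma residue_const a : residue (iota a) a.
Proof. by rewrite /residue subrr; left. Qed.

Lemma residue0P f : residue f 0 <-> order_ge v 1 f.
Proof. by rewrite /residue rmorph0 subr0. Qed.

Lemma residue_ge0 f a : residue f a -> order_ge v 0 f.
Proof.
move=> fa; rewrite -[f](subrK (iota a)); apply: (order_geD v_place).
  exact: order_geW fa.
exact: (order_ge_const v_place).
Qed.

Lemma residueD f g a b : residue f a -> residue g b -> residue (f + g) (a + b).
Proof.
move=> fa gb; rewrite /residue rmorphD opprD addrACA.
exact: (order_geD v_place).
Qed.

Lemma residueN f a : residue f a -> residue (- f) (- a).
Proof. by move=> fa; rewrite /residue rmorphN -opprD; exact: (order_geN v_place). Qed.

Lemma residueB f g a b : residue f a -> residue g b -> residue (f - g) (a - b).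
Proof. by move=> fa gb; apply: residueD => //; exact: residueN. Qed.

Lemma residueM f g a b : residue f a -> residue g b -> residue (f * g) (a * b).
Proof.
move=> fa gb; rewrite /residue rmorphM.
have -> : f * g - iota a * iota b = (f - iota a) * g + iota a * (g - iota b) by ring.
apply: (order_geD v_place).
  exact: (order_geM v_place fa (residue_ge0 gb)).
exact: (order_geM v_place (order_ge_const v_place a) gb).
Qed.

Lemma residueX f a n : residue f a -> residue (f ^+ n) (a ^+ n).
Proof.
move=> fa; elim: n => [|n IHn].
  by rewrite !expr0 -(rmorph1 iota); exact: residue_const.
by rewrite !exprS; exact: residueM.
Qed.

Lemma residue_unit f a : residue f a -> a != 0 -> order_eq v 0 f.
Proof.
move=> fa a0; rewrite -[f](subrK (iota a)) addrC; apply: (order_eqD v_place) => //.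
exact: (order_eq_const v_place).
Qed.

Lemma residue_inj f a b : residue f a -> residue f b -> a = b.
Proof.
move=> fa fb; apply/subr0_eq/(order_ge1_const v_place).
have -> : iota (a - b) = (f - iota b) - (f - iota a) by rewrite rmorphB; ring.
exact: (order_geB v_place).
Qed.

Lemma residue_eq0 a : residue 0 a -> a = 0.
Proof. by move=> h; apply: residue_inj h _; apply/residue0P; left. Qed.

Lemma residueV f a : residue f a -> a != 0 -> residue f^-1 a^-1.
Proof.
move=> fa a0; have f0 := residue_unit fa a0.
rewrite /residue fmorphV.
have -> : f^-1 - (iota a)^-1 = - ((f - iota a) * (f * iota a)^-1).
  by field; rewrite fmorph_eq0 a0 (proj1 f0).
rewrite -[1]addr0; apply: (order_geN v_place); apply: (order_geM v_place) => //.
apply: order_ge_eq; rewrite -oppr0; apply: (order_eqV v_place).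
by rewrite -[0]addr0; apply: (order_eqM v_place) => //; exact: (order_eq_const v_place).
Qed.

Lemma residue_affine_D2 q x y a b : residue x a -> residue y b ->
  residue (affine_D2 q x y) (affine_D2 q a b).
Proof.
by move=> xa yb; apply: residueB; apply: residueM; apply: residueB => //;
  do ?[apply: residueX].
Qed.

Lemma residue_affine_D1 q x y a b : residue x a -> residue y b ->
  residue (affine_D1 q x y) (affine_D1 q a b).
Proof.
by move=> xa yb; apply: residueB; apply: residueM; apply: residueB => //;
  do ?[apply: residueX].
Qed.

End Residue.

(** * D1 and D2 under changes of coordinates *)

Lemma affine_D1C (R : comNzRingType) q (x y : R) : affine_D1 q y x = - affine_D1 q x y.
Proof. by rewrite /affine_D1; ring. Qed.

Lemma affine_D2C (R : comNzRingType) q (x y : R) : affine_D2 q y x = - affine_D2 q x y.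
Proof. by rewrite /affine_D2; ring. Qed.

Lemma affine_D20 (R : comNzRingType) q (y : R) : (0 < q)%N -> affine_D2 q 0 y = 0.
Proof.
move=> q0; have zq : 0 ^+ q = 0 :> R by rewrite expr0n eqn0Ngt q0.
by rewrite /affine_D2 !zq; ring.
Qed.

Section AffineFrobenius.
Variables (R : comNzRingType) (q : nat).
Hypothesis q_pchar : [pchar R].-nat q.

Lemma affine_D1E (x y : R) : affine_D1 q x y =
  (x ^+ q - x) * ((y ^+ q - y) ^+ q + ((y ^+ q - y) ^+ q) ^+ q)
  - (y ^+ q - y) * ((x ^+ q - x) ^+ q + ((x ^+ q - x) ^+ q) ^+ q).
Proof. by rewrite /affine_D1 !(frobB q_pchar); ring. Qed.

Lemma affine_D2E (x y : R) : affine_D2 q x y =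
  (x ^+ q - x) * (y ^+ q - y) ^+ q - (y ^+ q - y) * (x ^+ q - x) ^+ q.
Proof. by rewrite /affine_D2 !(frobB q_pchar). Qed.

(** D1 depends only on r and s ([affine_D1E]) and does not change when a Frobenius-fixed multiple of
    r is added to s. Phrasing the shear through z^q - z allows z to differ from y - m x by any
    element fixed by Frobenius. *)
Lemma affine_D1_shear (x y z m : R) : m ^+ q = m ->
  z ^+ q - z = y ^+ q - y - m * (x ^+ q - x) ->
  affine_D1 q x z = affine_D1 q x y.
Proof.
by move=> mE zE; rewrite !affine_D1E zE !(frobB q_pchar, exprMn) !mE; ring.
Qed.

Lemma affine_D2_shear (x y z m : R) : m ^+ q = m ->
  z ^+ q - z = y ^+ q - y - m * (x ^+ q - x) ->
  affine_D2 q x z = affine_D2 q x y.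
Proof.
by move=> mE zE; rewrite !affine_D2E zE !(frobB q_pchar, exprMn) !mE; ring.
Qed.

End AffineFrobenius.

(** D1 is homogeneous of degree 1 + q + q^3, and (y/x : 1/x : 1) is (x : y : 1) with its coordinates
    permuted cyclically, which costs no sign. *)
Lemma affine_D1_infinity (L : fieldType) q (x y : L) : x != 0 ->
  affine_D1 q (y / x) x^-1 = affine_D1 q x y / (x * x ^+ q * ((x ^+ q) ^+ q) ^+ q).
Proof.
move=> x0; rewrite /affine_D1 !(exprMn, exprVn).
by field; rewrite x0 !expf_neq0.
Qed.

Lemma affine_D2_infinity (L : fieldType) q (x y : L) : x != 0 ->
  affine_D2 q (y / x) x^-1 = affine_D2 q x y / (x * x ^+ q * (x ^+ q) ^+ q).
Proof.
move=> x0; rewrite /affine_D2 !(exprMn, exprVn).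
by field; rewrite x0 !expf_neq0.
Qed.

Ltac local_ring_tac :=
  repeat first [exact: local_ring_t | exact: local_ring_u | exact: local_ring_const
    | exact: local_ring1 | apply: local_ringB | apply: local_ringD
    | apply: local_ringN | apply: local_ringM | apply: local_ringX].

(** * Excluding F_q-rational centers *)

Section Branches.
Variables (K L : fieldType) (iota : {rmorphism K -> L}) (v : L -> int) (q : nat).
Hypotheses (v_place : place iota v).
Hypothesis L_pchar : [pchar L].-nat q.
Hypothesis (q_gt1 : (1 < q)%N).

(* With r = x^q - x, s = y^q - y, m = s / r and g = m^q - m, one has
   D2 = r^(q+1) g and D1 = D2 (1 + r^(q^2-q) (g^(q-1) + 1)). *)
Lemma rational_center_affine_D2 x y a b : residue iota v x a -> residue iota v y b ->
  a ^+ q = a -> b ^+ q = b -> affine_D1 q x y = 0 -> affine_D2 q x y = 0.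
Proof.
(* Swapping [x] and [y] only changes the signs of D1 and D2, so s may be taken to vanish at least as
   much as r, which makes m = s / r regular. As [v 0] is unspecified, r = 0 is a separate case. *)
wlog le_xy : x y a b / x ^+ q - x = 0 \/ order_ge v (v (x ^+ q - x)) (y ^+ q - y).
  move=> H xa yb aE bE xy; have [r0|r0] := eqVneq (x ^+ q - x) 0;
    first by apply: (H x y a b) => //; left.
  have [le|lt] := leP (v (x ^+ q - x)) (v (y ^+ q - y)).
    by apply: (H x y a b) => //; right; right.
  apply/eqP; rewrite -oppr_eq0 -affine_D2C; apply/eqP; apply: (H y x b a) => //.
    by right; right; exact: ltW.
  by rewrite affine_D1C xy oppr0.
move=> xa _ aE _; have r_ge : order_ge v 1 (x ^+ q - x).
  by apply/(residue0P iota); rewrite -(subrr a) -{1}aE;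
    apply: (residueB v_place) => //; exact: (residueX v_place).
have [r0|r0] := eqVneq (x ^+ q - x) 0.
  by rewrite /affine_D2 -!(frobB L_pchar) r0 expr0n eqn0Ngt (ltnW q_gt1);
    rewrite /= mul0r mulr0 subrr.
case: le_xy => [/eqP|le_xy]; first by rewrite (negPf r0).
rewrite /affine_D1 /affine_D2.
have -> : ((y ^+ q) ^+ q) ^+ q - y ^+ q = (y ^+ q - y) ^+ q + ((y ^+ q - y) ^+ q) ^+ q.
  by rewrite !(frobB L_pchar); ring.
have -> : ((x ^+ q) ^+ q) ^+ q - x ^+ q = (x ^+ q - x) ^+ q + ((x ^+ q - x) ^+ q) ^+ q.
  by rewrite !(frobB L_pchar); ring.
rewrite -!(frobB L_pchar);
  move: (x ^+ q - x) (y ^+ q - y) r_ge r0 le_xy => r s r_ge r0 rs.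
have [m m_ge sE] : exists2 m, order_ge v 0 m & s = r * m.
  exists (s / r); last by rewrite mulrC divfK.
  have := order_geM v_place rs (order_ge_eq (order_eqV v_place (conj r0 erefl))).
  by rewrite subrr.
rewrite sE !exprMn; pose g := m ^+ q - m.
have -> : m ^+ q = g + m by rewrite /g; ring.
rewrite (frobD L_pchar) => E.
have g_ge : order_ge v 0 g.
  apply: (order_geB v_place) => //; by have := order_geX v_place q m_ge; rewrite mulr0.
have qE : q = q.-1.+1 by rewrite prednK // ltnW.
have E' : r * r ^+ q * g * (1 + (r ^+ q.-1) ^+ q * (g ^+ q.-1 + 1)) = 0.
  have E1 : r ^+ q * (r ^+ q.-1) ^+ q = (r ^+ q) ^+ q by rewrite -exprMn -exprS -qE.
  have E2 : g * g ^+ q.-1 = g ^+ q by rewrite -exprS -qE.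
  transitivity (r * r ^+ q * g + r * (r ^+ q * (r ^+ q.-1) ^+ q) * (g * g ^+ q.-1 + g)).
    by ring.
  rewrite E1 E2 -[RHS]E; have -> : m ^+ q = g + m by rewrite /g; ring.
  by ring.
(* r vanishes at the center because a is fixed by Frobenius, and g is regular; so this factor is a
   unit and g must be 0. *)
have u1 : order_eq v 0 (1 + (r ^+ q.-1) ^+ q * (g ^+ q.-1 + 1)).
  apply: (order_eqD v_place (order_eq1 v_place)); rewrite add0r -[1]addr0.
  apply: (order_geM v_place).
    apply: (order_geW (n := q%:Z * (q.-1%:Z * 1)));
      last exact/(order_geX v_place)/(order_geX v_place).
    by nia.
  apply: (order_geD v_place); last exact/order_ge_eq/(order_eq1 v_place).
  by have := order_geX v_place q.-1 g_ge; rewrite mulr0.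
have g0 : g = 0.
  apply/eqP; move/eqP: E';
    rewrite !mulf_eq0 expf_eq0 (negPf r0) (negPf (proj1 u1)) andbF orbF.
  by [].
by rewrite g0; ring.
Qed.

End Branches.

(** * Nonsingular points *)

Section SmoothPoint.
Variables (K : fieldType) (q : nat).
Hypotheses (K_pchar : [pchar K].-nat q) (q_gt1 : (1 < q)%N).

(** If r = 0 at (a, b), both terms of D2 vanish. If a^(q^3) = a^q, then D1 = 0 gives b^(q^3) = b^q;
    hence r^q = -r and s^q = -s, and the two terms of D2 cancel. *)
Lemma smooth_point_residues (a b : K) : affine_D1 q a b = 0 ->
  affine_D2 q a b != 0 ->
  a ^+ q - a != 0 /\ ((a ^+ q) ^+ q) ^+ q - a ^+ q != 0.
Proof.
rewrite /affine_D1 /affine_D2 -!(frobB K_pchar) => d1 d2.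
have r0 : a ^+ q - a != 0.
  by apply: contraNneq d2 => ->; rewrite expr0n eqn0Ngt (ltnW q_gt1) mulr0 mul0r subrr.
split=> //; apply: contraNneq d2 => R0; move/eqP: d1; rewrite R0 mulr0 subr0.
rewrite mulf_eq0 (negPf r0) /= => /eqP S0.
have rE : (a ^+ q - a) ^+ q = - (a ^+ q - a).
  by move/eqP: R0; rewrite expf_eq0 => /andP[_ /eqP R0]; apply/eqP;
    rewrite -addr_eq0 (frobB K_pchar) -[X in _ == X]R0; apply/eqP; ring.
have sE : (b ^+ q - b) ^+ q = - (b ^+ q - b).
  by move/eqP: S0; rewrite expf_eq0 => /andP[_ /eqP S0]; apply/eqP;
    rewrite -addr_eq0 (frobB K_pchar) -[X in _ == X]S0; apply/eqP; ring.
by apply/eqP; rewrite rE sE; ring.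
Qed.

Lemma smooth_rational (a b : K) : affine_D1 q a b = 0 -> affine_D2 q a b != 0 ->
  ((a ^+ q) ^+ q) ^+ q = a -> ((b ^+ q) ^+ q) ^+ q = b.
Proof.
move=> ab1 ab2 aE; have [r0 _] := smooth_point_residues ab1 ab2.
apply/eqP; rewrite -subr_eq0; apply/eqP; apply: (mulfI r0); rewrite mulr0 -[RHS]ab1.
by rewrite /affine_D1 aE; ring.
Qed.

End SmoothPoint.

Section Uniformizers.
Variables (K L : fieldType) (iota : {rmorphism K -> L}) (v : L -> int) (q : nat).
Hypotheses (v_place : place iota v).
Hypotheses (L_pchar : [pchar L].-nat q) (q_gt1 : (1 < q)%N).

Let K_pchar : [pchar K].-nat q.
Proof. by rewrite -(eq_pnat _ (fmorph_pchar iota)). Qed.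

(** With t = x - x0 and u = y - y0, the linear part of D1 at the center is R u - S t, where R =
    x0^(q^3) - x0^q and S = y0^(q^3) - y0^q. Since R <> 0, [u] is a multiple of [t], and dy/dx is
    regular by [der_affine_D1]. *)
Lemma smooth_point (x y : L) (x0 y0 : K) : generates iota x y ->
  residue iota v x x0 -> residue iota v y y0 ->
  affine_D1 q x y = 0 -> affine_D2 q x0 y0 != 0 -> x != iota x0 ->
  order_eq v 1 (x - iota x0) /\
  forall (d : L -> L) s, derivation iota d -> d x != 0 -> order_eq v 1 s ->
    d s != 0 /\ v (d s) = v (d x).
Proof.
move=> gen xr yr D1E D2n xn.
have d1 : affine_D1 q x0 y0 = 0.
  by apply: (residue_eq0 v_place); rewrite -D1E; exact: (residue_affine_D1 v_place).
have [r0 R0] := smooth_point_residues K_pchar q_gt1 d1 D2n.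
set t := x - iota x0; pose u := y - iota y0.
have t0 : t != 0 by rewrite subr_eq0.
have xE : x = iota x0 + t by rewrite /t; ring.
have yE : y = iota y0 + u by rewrite /u; ring.
have qE : q = q.-1.+1 by rewrite prednK // ltnW.
(* [a] and [b] are u^(q-1) and u^(q^3-1), so that u factors out of u^q and u^(q^3); [a'] and [b'] do
   the same for t. *)
pose a := u ^+ q.-1; pose b := a * a ^+ q * (a ^+ q) ^+ q.
pose a' := t ^+ q.-1; pose b' := a' * a' ^+ q * (a' ^+ q) ^+ q.
have u1E : u ^+ q = u * a by rewrite /a -exprS -qE.
have u3E : ((u ^+ q) ^+ q) ^+ q = u * b by rewrite /b u1E !exprMn u1E !exprMn u1E; ring.
have t1E : t ^+ q = t * a' by rewrite /a' -exprS -qE.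
have t3E : ((t ^+ q) ^+ q) ^+ q = t * b' by rewrite /b' t1E !exprMn t1E !exprMn t1E;
  ring.
pose r1 := iota (x0 ^+ q - x0); pose r3 := iota (((x0 ^+ q) ^+ q) ^+ q - x0 ^+ q).
pose s1 := iota (y0 ^+ q - y0); pose s3 := iota (((y0 ^+ q) ^+ q) ^+ q - y0 ^+ q).
have rsE : r1 * s3 = s1 * r3.
  by rewrite -!rmorphM; congr (iota _); apply/eqP; rewrite -subr_eq0; apply/eqP.
pose M := r1 * (b - a) - (a - 1) * (r3 + t * b' - t * a').
pose N := s1 * (b' - a') - (a' - 1) * (s3 + u * b - u * a).
(* The expansion of D1 = 0 at (x0, y0), with M a unit since M(P) = r3 <> 0. *)
have MN : u * M = t * N.
  have : (r1 + t * a' - t) * (s3 + u * b - u * a)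
      - (s1 + u * a - u) * (r3 + t * b' - t * a') = 0.
    rewrite -[RHS]D1E /affine_D1 -u1E -u3E -t1E -t3E xE yE !(frobD L_pchar).
    by rewrite /r1 /r3 /s1 /s3 !rmorphB !rmorphXn; ring.
  move/eqP; rewrite -subr_eq0 subr0 => /eqP E; apply/eqP; rewrite -subr_eq0; apply/eqP.
  transitivity ((r1 + t * a' - t) * (s3 + u * b - u * a)
      - (s1 + u * a - u) * (r3 + t * b' - t * a') - (r1 * s3 - s1 * r3)).
    by rewrite /M /N; ring.
  by rewrite E rsE; ring.
have tr : residue iota v t 0 by apply/residue0P.
have ur : residue iota v u 0 by apply/residue0P.
have z1 : (0 : K) ^+ q.-1 = 0 by rewrite expr0n; have -> : (q.-1 == 0)%N = false by lia.
have ar : residue iota v a 0 by rewrite -z1; exact: (residueX v_place).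
have br : residue iota v b 0.
  have arq := residueX v_place q ar.
  have := residueM v_place (residueM v_place ar arq) (residueX v_place q arq).
  by rewrite !mul0r.
have a'r : residue iota v a' 0 by rewrite -z1; exact: (residueX v_place).
have b'r : residue iota v b' 0.
  have arq := residueX v_place q a'r.
  have := residueM v_place (residueM v_place a'r arq) (residueX v_place q arq).
  by rewrite !mul0r.
have Mu : order_eq v 0 M.
  apply: (residue_unit v_place) R0.
  have -> : ((x0 ^+ q) ^+ q) ^+ q - x0 ^+ q = (x0 ^+ q - x0) * (0 - 0) -
      (0 - 1) * (((x0 ^+ q) ^+ q) ^+ q - x0 ^+ q + 0 * 0 - 0 * 0) by ring.
  have c1 : residue iota v 1 1 by rewrite -{1}(rmorph1 iota); exact: residue_const.
  apply: (residueB v_place); apply: (residueM v_place);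
    do ?apply: (residueB v_place) => //;
    do ?apply: (residueD v_place); do ?exact: residue_const; exact: (residueM v_place).
have Mr : local_ring iota v t u M by rewrite /M /b /b' /a /a' /r1 /r3; local_ring_tac.
have Nr : local_ring iota v t u N by rewrite /N /b /b' /a /a' /s1 /s3; local_ring_tac.
have u_in : exists2 h, local_ring iota v t u h & u = t * h.
  exists (N / M); first by apply: local_ringM => //; exact: local_ringV.
  by rewrite mulrA -MN mulfK // (proj1 Mu).
have frT : forall f, local_fraction iota v t u f.
  apply: (local_fraction_generates gen); apply: local_fraction_ring.
    by rewrite xE; local_ring_tac.
  by rewrite yE; local_ring_tac.
have t1 := local_uniformizer v_place t0 xr yr u_in frT.
split=> // d s d_der dx0.
have dtE : d t = d x by rewrite (derB d_der) (derivation_const d_der) subr0.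
have duE : d u = d y by rewrite (derB d_der) (derivation_const d_der) subr0.
rewrite -dtE; apply: (local_uniformizer_der v_place t0 xr yr u_in frT d_der);
  rewrite dtE //.
have x3 : order_eq v 0 (((x ^+ q) ^+ q) ^+ q - x ^+ q).
  by apply: (residue_unit v_place) R0; apply: (residueB v_place);
    do ?[apply: (residueX v_place)].
have E := der_affine_D1 L_pchar q_gt1 d_der D1E.
have -> : d u / d x = (((y ^+ q) ^+ q) ^+ q - y ^+ q) / (((x ^+ q) ^+ q) ^+ q - x ^+ q).
  by rewrite duE; apply/eqP; rewrite eqr_div ?(proj1 x3) // -E mulrC.
rewrite -[0]addr0; apply: (order_geM v_place).
  apply: (residue_ge0 v_place (a := ((y0 ^+ q) ^+ q) ^+ q - y0 ^+ q)).
  by apply: (residueB v_place); do ?[apply: (residueX v_place)].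
by apply: order_ge_eq; rewrite -oppr0; apply: (order_eqV v_place).
Qed.

End Uniformizers.

(** * Cusps *)

Section Cusp.
Variables (K L : fieldType) (iota : {rmorphism K -> L}) (v : L -> int) (q : nat).
Hypotheses (v_place : place iota v).
Hypothesis (q_gt1 : (1 < q)%N).

Lemma order_eq_frobB f n : 0 < n -> order_eq v n f -> order_eq v n (f ^+ q - f).
Proof.
move=> n0 fn; rewrite addrC; apply: (order_eqD v_place);
  first exact: (order_eqN v_place).
by apply: order_geW (order_ge_eq (order_eqX v_place q fn)); nia.
Qed.

Lemma order_eq_frobB2 f n : 0 < n -> order_eq v n f ->
  order_eq v n ((f ^+ q) ^+ q - f).
Proof.
move=> n0 fn; rewrite addrC; apply: (order_eqD v_place);
  first exact: (order_eqN v_place).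
apply: order_geW (order_ge_eq (order_eqX v_place q (order_eqX v_place q fn))).
have : q%:Z * n >= n + 1 by nia.
by nia.
Qed.

Lemma order_eq_frobB3 f n : 0 < n -> order_eq v n f ->
  order_eq v n (((f ^+ q) ^+ q) ^+ q - f).
Proof.
move=> n0 fn; have f2 := order_eqX v_place q (order_eqX v_place q fn).
rewrite addrC; apply: (order_eqD v_place); first exact: (order_eqN v_place).
apply: order_geW (order_ge_eq (order_eqX v_place q f2)).
have q1 : q%:Z * n >= n + 1 by nia.
have q2 : q%:Z * (q%:Z * n) >= n + 1 by nia.
by nia.
Qed.

Hypothesis L_pchar : [pchar L].-nat q.

(** r is a unit and s has the order n of y, so the term s r^q dominates r s^q, of order q n. *)
Lemma order_eq_affine_D2 x y a n : residue iota v x a -> a ^+ q != a ->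
  0 < n -> order_eq v n y -> order_eq v n (affine_D2 q x y).
Proof.
move=> xa an n0 yn; rewrite /affine_D2 -!(frobB L_pchar).
have r0 : order_eq v 0 (x ^+ q - x).
  apply: (residue_unit v_place (a := a ^+ q - a)); last by rewrite subr_eq0.
  by apply: (residueB v_place) => //; exact: (residueX v_place).
have s1 := order_eq_frobB n0 yn.
rewrite addrC; apply: (order_eqD v_place).
  apply: (order_eqN v_place); rewrite -[n]addr0; apply: (order_eqM v_place) => //.
  by have := order_eqX v_place q r0; rewrite mulr0.
have := order_ge_eq (order_eqM v_place r0 (order_eqX v_place q s1)).
by apply: order_geW; nia.
Qed.

(* Near the cusp the curve looks like y^(q-1) = c (x - a)^q, so that
   t = y / (x - a) is a local parameter. *)
Lemma cusp (x y : L) (a : K) : generates iota x y ->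
  residue iota v x a -> a ^+ q != a -> order_ge v 1 y ->
  affine_D1 q x y = 0 -> affine_D2 q x y != 0 ->
  [/\ (a ^+ q) ^+ q = a, order_eq v (q%:Z - 1) (x - iota a), order_eq v q y &
    forall (d : L -> L) s, derivation iota d -> d x != 0 \/ d y != 0 -> order_eq v 1
      s ->
    [/\ d s != 0, order_eq v (v (d s) + q%:Z - 2) (d x) &
        order_eq v (v (d s) + 2 * q%:Z - 2) (d y)]].
Proof.
move=> gen xr an yr D1E D2n.
have y0 : y != 0.
  apply: contraNneq D2n => ->; rewrite affine_D2C affine_D20 ?oppr0 //.
  exact: ltnW.
have r0 : order_eq v 0 (x ^+ q - x).
  apply: (residue_unit v_place (a := a ^+ q - a)); last by rewrite subr_eq0.
  by apply: (residueB v_place) => //; exact: (residueX v_place).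
set m := v y; have ym : order_eq v m y by [].
have m0 : 0 < m by have := order_eq_ge ym yr; lia.
have D1F : (x ^+ q - x) * ((y ^+ q) ^+ q - y) ^+ q =
    (y ^+ q - y) * ((x ^+ q) ^+ q - x) ^+ q.
  by apply/eqP; rewrite -subr_eq0 !(frobB L_pchar); apply/eqP.
have lhs := order_eqM v_place r0 (order_eqX v_place q (order_eq_frobB2 m0 ym)).
have E0 : (x ^+ q) ^+ q - x != 0.
  have := proj1 lhs; rewrite D1F mulf_eq0 expf_eq0 (ltnW q_gt1) /=.
  by rewrite negb_or => /andP[].
set n := v ((x ^+ q) ^+ q - x); have En : order_eq v n ((x ^+ q) ^+ q - x) by [].
(* Comparison of the orders of the two sides of [D1F]: q m = m + q n. *)
have mnE : (q%:Z - 1) * (m - n) = n.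
  have := order_eqM v_place (order_eq_frobB m0 ym) (order_eqX v_place q En).
  by rewrite -D1F => /(order_eq_inj lhs); lia.
(* Otherwise n = 0, and then (q - 1) m = 0, against m > 0. *)
have aE : (a ^+ q) ^+ q = a.
  apply/eqP; rewrite -subr_eq0; apply/negPn/negP => an2.
  have : order_eq v 0 ((x ^+ q) ^+ q - x).
    by apply: (residue_unit v_place) an2; apply: (residueB v_place) => //;
      do ?[apply: (residueX v_place)].
  move=> /(order_eq_inj En) n0; move: mnE; rewrite n0; nia.
pose u := x - iota a.
have xE : x = iota a + u by rewrite /u; ring.
have EE : (x ^+ q) ^+ q - x = (u ^+ q) ^+ q - u.
  by rewrite {1 2}xE !(frobD L_pchar) -!rmorphXn aE; ring.
have u0 : u != 0.
  apply: contraNneq E0 => u0; rewrite EE u0 expr0n eqn0Ngt (ltnW q_gt1) /= subr0.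
  by rewrite expr0n eqn0Ngt (ltnW q_gt1).
have un : order_eq v n u.
  split=> //; have uv : 0 < v u by case: (xr : order_ge v 1 u) => [/eqP|];
    [rewrite (negPf u0) | lia].
  by have := order_eq_frobB2 uv (conj u0 erefl); rewrite -EE => /(order_eq_inj En).
have n0 : 0 < n by have := order_eq_ge un xr; lia.
(* Since n = (q - 1) (m - n), the order m - n of [t] is positive; once it is known to be 1, n = q -
   1 and m = q follow. *)
pose t := y / u; have t0 : t != 0 by rewrite mulf_neq0 ?invr_neq0.
have tmn : order_eq v (m - n) t by apply: (order_eqM v_place) => //;
  exact: (order_eqV v_place).
have t_gt0 : order_ge v 1 t by apply: order_geW (order_ge_eq tmn); nia.
have yE : y = t * u by rewrite /t divfK.
have q1E : q = q.-1.+1 by rewrite prednK // ltnW.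
have q2E : q.-1 = q.-2.+1 by lia.
pose b := y ^+ q.-1; pose c := u ^+ q.-1.
have bE : y ^+ q = y * b by rewrite -exprS -q1E.
have cE : u ^+ q = u * c by rewrite -exprS -q1E.
pose M := (b - 1) * (c * c ^+ q - 1) ^+ q.
pose N := t ^+ q.-2 * (x ^+ q - x) * (b * b ^+ q - 1) ^+ q.
(* D1 = 0 divided by y u^(q-1); again M is a unit. *)
have MN : u * M = t * N.
  have h0 : y * c != 0 by rewrite mulf_neq0 ?expf_neq0.
  apply: (mulfI h0); transitivity ((y ^+ q - y) * ((x ^+ q) ^+ q - x) ^+ q).
    rewrite EE !cE exprMn bE cE /M;
      have -> : u * c * c ^+ q - u = u * (c * c ^+ q - 1) by ring.
    by rewrite exprMn cE; ring.
  rewrite -D1F bE exprMn bE /N;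
    have -> : y * b * b ^+ q - y = y * (b * b ^+ q - 1) by ring.
  rewrite exprMn bE; have -> : b = t * t ^+ q.-2 * c by rewrite /b yE exprMn -exprS
    -q2E.
  by ring.
have bc_order f k : 0 < k -> order_eq v k f -> order_ge v 1 (f ^+ q.-1).
  move=> k0 fk; apply: order_geW (order_ge_eq (order_eqX v_place q.-1 fk)); nia.
have b1 := bc_order y m m0 ym; have c1 := bc_order u n n0 un.
have cc1 : order_ge v 1 (c * c ^+ q).
  rewrite -exprS; apply: order_geW (order_geX v_place q.+1 c1); lia.
have one_unit f : order_ge v 1 f -> order_eq v 0 (f - 1).
  move=> f1; rewrite addrC; apply: (order_eqD v_place) => //.
  exact/(order_eqN v_place)/(order_eq1 v_place).
have Mu : order_eq v 0 M.
  rewrite -[0]addr0; apply: (order_eqM v_place); first exact: one_unit.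
  by have := order_eqX v_place q (one_unit _ cc1); rewrite mulr0.
have Mr : local_ring iota v t u M.
  rewrite /M /b /c yE; local_ring_tac.
have Nr : local_ring iota v t u N.
  rewrite /N /b yE xE; local_ring_tac.
have u_in : exists2 h, local_ring iota v t u h & u = t * h.
  exists (N / M); first by apply: local_ringM => //; exact: local_ringV.
  by rewrite mulrA -MN mulfK // (proj1 Mu).
have frT : forall f, local_fraction iota v t u f.
  apply: (local_fraction_generates gen); apply: local_fraction_ring.
    by rewrite xE; local_ring_tac.
  by rewrite yE; local_ring_tac.
have t1 := local_uniformizer v_place t0 t_gt0 xr u_in frT.
have mn1 := order_eq_inj tmn t1; rewrite mn1 mulr1 in mnE.
have mE : m = q%:Z by lia.
split=> //; first by rewrite mnE; exact: un.
move=> d s d_der dxy s1.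
have E := der_affine_D1 L_pchar q_gt1 d_der D1E.
rewrite -!(frobB L_pchar) in E.
have y3 := order_eqX v_place q (order_eq_frobB2 m0 ym).
have x3 := order_eqX v_place q En.
(* Depending on the chart, either d x or d y is known to be nonzero; the tangent relation [E] passes
   from the second to the first. *)
have dx0 : d x != 0.
  case: dxy => // dy0; apply: contraNneq (mulf_neq0 dy0 (proj1 x3)) => dx0.
  by rewrite -E dx0 mul0r.
have dxv : order_eq v (v (d x)) (d x) by [].
have dyv : order_eq v (v (d x) + q%:Z) (d y).
  have := order_eqM v_place dxv y3;
    rewrite E [d y * _]mulrC => /(order_eqM_inv v_place x3).
  by congr order_eq; rewrite -mnE mE; ring.
have duE : d u = d x by rewrite (derB d_der) (derivation_const d_der) subr0.
(* In u dt = dy - t dx the term t dx, of order v(dx) + 1, dominates dy, of order v(dx) + q. *)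
have dtv : order_eq v (v (d x) + 2 - q%:Z) (d t).
  have dtE : u * d t = - (t * d x) + d y.
    by rewrite yE (derivationM d_der) duE; ring.
  have : order_eq v (1 + v (d x)) (u * d t).
    rewrite dtE; apply: (order_eqD v_place).
      exact/(order_eqN v_place)/(order_eqM v_place).
    by apply: order_geW (order_ge_eq dyv); lia.
  move/(order_eqM_inv v_place un); congr order_eq; lia.
have [] := local_uniformizer_der v_place t0 t_gt0 xr u_in frT d_der (proj1 dtv) _ s1.
  rewrite duE; apply: order_geW (order_ge_eq (order_eqM v_place dxv (order_eqV
    v_place dtv))).
  by lia.
move=> ds0 dsE; rewrite dsE (proj2 dtv); split=> //.
  by congr (order_eq v _ _): dxv; lia.
by congr (order_eq v _ _): dyv; lia.
Qed.

End Cusp.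

(** * The divisor S *)

Lemma rational_over_ratio (K : fieldType) (Q : nat) (P : 'rV[K]_3) i j :
  rational_over Q P -> (P 0 i / P 0 j) ^+ Q = P 0 i / P 0 j.
Proof.
move=> [c c0 cP]; have -> : P 0 i / P 0 j = (c * P 0 i) / (c * P 0 j).
  by rewrite -mulf_div divff // mul1r.
by rewrite exprMn exprVn !cP.
Qed.

Section StohrVoloch.
Variables (K L : fieldType) (iota : {rmorphism K -> L}) (v : L -> int) (q : nat).
Hypotheses (v_place : place iota v).
Hypotheses (L_pchar : [pchar L].-nat q) (q_gt1 : (1 < q)%N).
Variables (x y : L) (D : nat -> L -> L).
Hypotheses (D_hasse : hasse_derivatives iota x D) (xy_gen : generates iota x y).
Hypotheses (xy_D1 : affine_D1 q x y = 0) (xy_D2 : affine_D2 q x y != 0).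

Let D_der := hasse_derivation D_hasse.

Let K_pchar : [pchar K].-nat q.
Proof. by rewrite -(eq_pnat _ (fmorph_pchar iota)). Qed.

Lemma order_eq_W_S (a b c e : int) :
  order_eq v a (x ^+ q - x) -> order_eq v b ((x ^+ q) ^+ q - x) ->
  order_eq v c (((x ^+ q) ^+ q) ^+ q - x) -> order_eq v e (affine_D2 q x y) ->
  order_eq v (c + e - q%:Z * (a + b)) (W_S q D x y).
Proof.
move=> ra rb rc re; have := order_eqN v_place (order_eqM v_place rc re).
rewrite -(W_S_formula L_pchar q_gt1 D_hasse xy_D1) [W_S q D x y * _]mulrC -mulrA [W_S
  q D x y * _]mulrC mulrA.
move/(order_eqM_inv v_place (order_eqM v_place (order_eqX v_place q ra) (order_eqX
  v_place q rb))).
by congr order_eq; ring.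
Qed.

(** [D 1] is d/dx, so dx/ds is the inverse of [D 1 s]; hence the sign of n. *)
Lemma SV_coefI (w n l : int) : order_eq v w (W_S q D x y) ->
  (forall s, order_eq v 1 s -> order_eq v (- n) (D 1 s)) ->
  line_mult iota x y v 0 0 1 = l ->
  SV_coef iota q D x y v (w + q%:Z * n + (q + 2)%:Z * l).
Proof.
move=> [W0 Wv] Dn <-; split=> //; exists n; last by rewrite Wv.
move=> t t0 tv; have [Dt0 Dtv] := Dn t (conj t0 tv).
exists (fun f => (D 1 t)^-1 * D 1 f); split.
- exact: derivationZ.
- exact: mulVf.
- by rewrite (hasse1X D_hasse) mulr1 invr_eq0.
- rewrite (hasse1X D_hasse) mulr1 -[n]opprK -Dtv.
  by have [] := order_eqV v_place (conj Dt0 erefl).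
Qed.

Lemma line_multE : line_mult iota x y v 0 0 1 = - Num.min (v x) (Num.min (v y) 0).
Proof.
by rewrite /line_mult rmorph0 !mul0r !add0r rmorph1 (proj2 (order_eq1 v_place)) sub0r.
Qed.

Let x0 : x != 0.
Proof. by apply: contraNneq xy_D2 => ->; rewrite affine_D20 // ltnW. Qed.

Let y0 : y != 0.
Proof.
by apply: contraNneq xy_D2 => ->; rewrite affine_D2C affine_D20 ?oppr0 // ltnW.
Qed.

Lemma line_mult_affine a b : residue iota v x a -> residue iota v y b ->
  line_mult iota x y v 0 0 1 = 0.
Proof.
move=> xa yb.
have xv : 0 <= v x by case: (residue_ge0 v_place xa) => // /eqP; rewrite (negPf x0).
have yv : 0 <= v y by case: (residue_ge0 v_place yb) => // /eqP; rewrite (negPf y0).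
by rewrite line_multE (min_idPr yv) (min_idPr xv) oppr0.
Qed.

Let x_neq_const a : x != iota a.
Proof.
apply/eqP => xE; have := hasse1X D_hasse; rewrite xE (derivation_const D_der).
by move/eqP; rewrite eq_sym oner_eq0.
Qed.

Lemma SV_coef_smooth a b : residue iota v x a -> residue iota v y b ->
  affine_D2 q a b != 0 ->
  SV_coef iota q D x y v (((a ^+ q) ^+ q) ^+ q == a)%:R.
Proof.
move=> xa yb ab2.
have ab1 : affine_D1 q a b = 0.
  by apply: (residue_eq0 v_place); rewrite -xy_D1; exact: (residue_affine_D1 v_place).
have [r0 R0] := smooth_point_residues K_pchar q_gt1 ab1 ab2.
have [t1 Ds] := smooth_point v_place L_pchar q_gt1 xy_gen xa yb xy_D1 ab2
  (x_neq_const a).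
have E0 : (a ^+ q) ^+ q - a != 0.
  by move: R0; rewrite -(frobB K_pchar) expf_eq0 (ltnW q_gt1).
have rx : order_eq v 0 (x ^+ q - x).
  by apply: (residue_unit v_place) r0; apply: (residueB v_place) => //;
    apply: (residueX v_place).
have ex : order_eq v 0 ((x ^+ q) ^+ q - x).
  by apply: (residue_unit v_place) E0; apply: (residueB v_place) => //;
    do ?[apply: (residueX v_place)].
have x3 : order_eq v (((a ^+ q) ^+ q) ^+ q == a)%:R (((x ^+ q) ^+ q) ^+ q - x).
  have [aE|an] := eqVneq (((a ^+ q) ^+ q) ^+ q) a.
    (* Here x^(q^3) - x = t^(q^3) - t for t = x - a. *)
    have := order_eq_frobB3 v_place q_gt1 ltr01 t1.
    by rewrite !(frobB L_pchar) -!rmorphXn aE; congr order_eq; ring.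
  apply: (residue_unit v_place (a := ((a ^+ q) ^+ q) ^+ q - a));
    last by rewrite subr_eq0.
  by apply: (residueB v_place) => //; do ?[apply: (residueX v_place)].
have d2 : order_eq v 0 (affine_D2 q x y).
  by apply: (residue_unit v_place) ab2; exact: (residue_affine_D2 v_place).
have := SV_coefI (n := 0) (order_eq_W_S rx ex x3 d2) _ (line_mult_affine xa yb).
rewrite !(mulr0, addr0, subr0); apply=> s s1; have [] := Ds _ _ D_der _ s1.
  by rewrite (hasse1X D_hasse) oner_neq0.
by rewrite (hasse1X D_hasse) (proj2 (order_eq1 v_place)) oppr0.
Qed.

(* The center lies on the F_q-line y - b = m (x - a). *)
Lemma SV_coef_cusp a b : residue iota v x a -> residue iota v y b ->
  affine_D2 q a b = 0 -> a ^+ q != a ->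
  (a ^+ q) ^+ q = a /\ SV_coef iota q D x y v 0.
Proof.
move=> xa yb ab2 an; have r0 : a ^+ q - a != 0 by rewrite subr_eq0.
(* Slope of the F_q-line through (a, b): as a is not in F_q, D2(a, b) = 0 amounts to m^q = m. *)
pose m := (b ^+ q - b) / (a ^+ q - a).
have mE : m ^+ q = m.
  rewrite /m exprMn exprVn; apply/eqP; rewrite eqr_div ?expf_neq0 //.
  by rewrite -subr_eq0 -[X in _ == X]ab2 (affine_D2E K_pchar); apply/eqP; ring.
pose z := y - iota b - iota m * (x - iota a).
have yE : y = z + iota b + iota m * (x - iota a) by rewrite /z; ring.
have zE : z ^+ q - z = y ^+ q - y - iota m * (x ^+ q - x).
  rewrite /z !(frobB L_pchar) exprMn (frobB L_pchar) -!rmorphXn mE.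
  have : iota m * (iota (a ^+ q) - iota a) = iota (b ^+ q) - iota b.
    by rewrite -!rmorphB -rmorphM /m divfK.
  move/eqP; rewrite -subr_eq0 => /eqP E; apply/eqP; rewrite -subr_eq0 -[X in _ == X]E.
  by apply/eqP; ring.
have imE : iota m ^+ q = iota m by rewrite -rmorphXn mE.
have z1 : order_ge v 1 z.
  apply: (order_geB v_place) => //; rewrite -[1]add0r.
  by apply: (order_geM v_place) => //; exact: (order_ge_const v_place).
have gen : generates iota x z.
  move=> Q Qc QD QM QV Qx Qz; apply: (xy_gen) => //; rewrite yE.
  apply: (QD); first by apply: (QD).
  by apply: (QM) => //; apply: (QD) => //; rewrite -rmorphN.
have xz1 : affine_D1 q x z = 0 by rewrite (affine_D1_shear L_pchar imE zE).
have xz2 := affine_D2_shear L_pchar imE zE.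
have xz20 : affine_D2 q x z != 0 by rewrite xz2.
have [aE un zn Ds] := cusp v_place q_gt1 L_pchar gen xa an z1 xz1 xz20.
split=> //.
have rx : order_eq v 0 (x ^+ q - x).
  by apply: (residue_unit v_place) r0; apply: (residueB v_place) => //;
    apply: (residueX v_place).
have ex : order_eq v (q%:Z - 1) ((x ^+ q) ^+ q - x).
  have q1 : 0 < q%:Z - 1 by lia.
  have := order_eq_frobB2 v_place q_gt1 q1 un.
  by rewrite !(frobB L_pchar) -!rmorphXn aE; congr order_eq; ring.
(* a lies in F_(q^2) but not in F_q, so a^(q^3) = a^q <> a. *)
have x3 : order_eq v 0 (((x ^+ q) ^+ q) ^+ q - x).
  apply: (residue_unit v_place) r0; rewrite -{1}aE.
  by apply: (residueB v_place) => //; do ?[apply: (residueX v_place)].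
have d2 : order_eq v q (affine_D2 q x y).
  rewrite -xz2; apply: (order_eq_affine_D2 v_place q_gt1 L_pchar xa an) zn; lia.
(* W_S has order q - q (q - 1) and dx has order q - 2, which balance. *)
have := SV_coefI (n := q%:Z - 2) (order_eq_W_S rx ex x3 d2) _ (line_mult_affine xa yb).
have -> : 0 + q%:Z - q%:Z * (0 + (q%:Z - 1)) + q%:Z * (q%:Z - 2) + (q + 2)%:Z * 0 = 0
  by ring.
apply=> s s1; have [|ds0 [_ dxv] _] := Ds _ _ D_der _ s1.
  by left; rewrite (hasse1X D_hasse) oner_neq0.
split=> //; move: dxv; rewrite (hasse1X D_hasse) (proj2 (order_eq1 v_place)); lia.
Qed.

(** The F_q-line through the center is x = a, so [cusp] applies with the coordinates exchanged: x -
    a now vanishes to order q, and dx to order 2 q - 2. *)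
Lemma SV_coef_vertical_cusp a b : residue iota v x a -> residue iota v y b ->
  a ^+ q = a -> b ^+ q != b ->
  (b ^+ q) ^+ q = b /\ SV_coef iota q D x y v 0.
Proof.
move=> xa yb aE bn; pose z := x - iota a.
have xE : x = z + iota a by rewrite /z subrK.
have zE : z ^+ q - z = x ^+ q - x - 0 * (y ^+ q - y).
  by rewrite /z (frobB L_pchar) -rmorphXn aE; ring.
have q0 := ltnW q_gt1.
have m0 : 0 ^+ q = 0 :> L by rewrite expr0n eqn0Ngt q0.
have gen : generates iota y z.
  move=> Q Qc QD QM QV Qy Qz; apply: (xy_gen) => //; rewrite xE.
  by apply: (QD).
have yz1 : affine_D1 q y z = 0.
  by rewrite (affine_D1_shear L_pchar m0 zE) affine_D1C xy_D1 oppr0.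
have yz2 : affine_D2 q y z = - affine_D2 q x y.
  by rewrite (affine_D2_shear L_pchar m0 zE) affine_D2C.
have yz20 : affine_D2 q y z != 0 by rewrite yz2 oppr_eq0.
have [bE un zn Ds] := cusp v_place q_gt1 L_pchar gen yb bn xa yz1 yz20.
split=> //.
have q0z : 0 < q%:Z by lia.
have rx : order_eq v q (x ^+ q - x).
  have := order_eq_frobB v_place q_gt1 q0z zn.
  by rewrite /z !(frobB L_pchar) -!rmorphXn aE; congr order_eq; ring.
have ex : order_eq v q ((x ^+ q) ^+ q - x).
  have := order_eq_frobB2 v_place q_gt1 q0z zn.
  by rewrite /z !(frobB L_pchar) -!rmorphXn !aE; congr order_eq; ring.
have x3 : order_eq v q (((x ^+ q) ^+ q) ^+ q - x).
  have := order_eq_frobB3 v_place q_gt1 q0z zn.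
  by rewrite /z !(frobB L_pchar) -!rmorphXn !aE; congr order_eq; ring.
have d2 : order_eq v q (affine_D2 q x y).
  rewrite -[affine_D2 q x y]opprK -yz2; apply: (order_eqN v_place).
  exact: (order_eq_affine_D2 v_place q_gt1 L_pchar yb bn q0z zn).
have := SV_coefI (n := 2 * q%:Z - 2) (order_eq_W_S rx ex x3 d2) _ (line_mult_affine
  xa yb).
have -> : q%:Z + q%:Z - q%:Z * (q%:Z + q%:Z) + q%:Z * (2 * q%:Z - 2) + (q + 2)%:Z * 0
  = 0 by ring.
have dz : D 1 z = 1 by rewrite /z (derB D_der) (derivation_const D_der) subr0
  (hasse1X D_hasse).
apply=> s s1; have [|ds0 _ [_ dzv]] := Ds _ _ D_der _ s1.
  by right; rewrite dz oner_neq0.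
split=> //; move: dzv; rewrite dz (proj2 (order_eq1 v_place)); lia.
Qed.

(** The line at infinity is itself an F_q-line, and [cusp] applies to (y/x, 1/x). So x has a pole of
    order q, V contributes q, and d(1/x) = -dx / x^2, of order 2 q - 2, gives dx the order -2. *)
Lemma SV_coef_infinite_cusp a : residue iota v (y / x) a -> residue iota v x^-1 0 ->
  a ^+ q != a -> (a ^+ q) ^+ q = a /\ SV_coef iota q D x y v 0.
Proof.
move=> ya x_inf an; pose u := y / x; pose z := x^-1.
have gen : generates iota u z.
  move=> Q Qc QD QM QV Qu Qz.
  have Qx : Q x by rewrite -[x]invrK; exact: QV.
  by apply: (xy_gen) => //; rewrite -[y](divfK x0); exact: QM.
have uz1 : affine_D1 q u z = 0 by rewrite affine_D1_infinity // xy_D1 mul0r.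
have uz2 := affine_D2_infinity q y x0.
have uz20 : affine_D2 q u z != 0.
  by rewrite uz2 mulf_neq0 // invr_neq0 // !mulf_neq0 ?expf_neq0.
have z1 : order_ge v 1 z by apply/(residue0P iota).
have [aE un zn Ds] := cusp v_place q_gt1 L_pchar gen ya an z1 uz1 uz20.
split=> //.
have q0z : 0 < q%:Z by lia.
have xn : order_eq v (- q%:Z) x by rewrite -[x]invrK; exact: (order_eqV v_place).
have xq := order_eqX v_place q xn; have xqq := order_eqX v_place q xq.
have xqqq := order_eqX v_place q xqq.
have pole k f : k < - q%:Z -> order_eq v k f -> order_eq v k (f - x).
  move=> kq fk; apply: (order_eqD v_place) => //; apply: (order_geN v_place).
  by apply: order_geW (order_ge_eq xn); lia.
have q1 : q%:Z * - q%:Z < - q%:Z by nia.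
have q2 : q%:Z * (q%:Z * - q%:Z) < - q%:Z by nia.
have q3 : q%:Z * (q%:Z * (q%:Z * - q%:Z)) < - q%:Z by nia.
have rx := pole _ _ q1 xq; have ex := pole _ _ q2 xqq; have x3 := pole _ _ q3 xqqq.
have d2 : order_eq v (q%:Z + (- q%:Z + q%:Z * - q%:Z + q%:Z * (q%:Z * - q%:Z)))
  (affine_D2 q x y).
  have -> : affine_D2 q x y = affine_D2 q u z * (x * x ^+ q * (x ^+ q) ^+ q).
    by rewrite uz2 divfK // !mulf_neq0 ?expf_neq0.
  apply: (order_eqM v_place).
    exact: (order_eq_affine_D2 v_place q_gt1 L_pchar ya an q0z zn).
  by apply: (order_eqM v_place) => //; exact: (order_eqM v_place).
have lE : line_mult iota x y v 0 0 1 = q.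
  have a0 : a != 0 by apply: contraNneq an => ->; rewrite expr0n eqn0Ngt (ltnW q_gt1).
  have yn : v y = - q%:Z.
    have := order_eqM v_place (residue_unit v_place ya a0) xn.
    by rewrite divfK // add0r => -[].
  rewrite line_multE yn (proj2 xn); have /min_idPl -> : - q%:Z <= 0 by lia.
  by rewrite minxx opprK.
have := SV_coefI (n := - 2) (order_eq_W_S rx ex x3 d2) _ lE.
set w := (X in SV_coef _ _ _ _ _ _ X); have -> : w = 0 by rewrite /w PoszD; ring.
have dz : D 1 z = - z ^+ 2 by rewrite /z (derV D_der) // (hasse1X D_hasse) exprVn
  mulN1r.
have z2 := order_eqN v_place (order_eqX v_place 2 zn).
apply=> s s1; have [|ds0 _ dzv] := Ds _ _ D_der _ s1.
  by right; rewrite dz (proj1 z2).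
split=> //; move: dzv; rewrite dz => /(order_eq_inj z2); lia.
Qed.

End StohrVoloch.

Theorem proposition8p7
  (p h q : nat) (p_prime : prime p) (def_q : q = (p ^ h)%N) (q_ge3 : (3 <= q)%N)
  (* K is an algebraic closure of the field Fq with q elements *)
  (Fq : finFieldType) (card_Fq : #|Fq| = q)
  (K : closedFieldType) (emb : {rmorphism Fq -> K})
  (K_alg : forall a : K, algebraicOver emb a)
  (* F = D1 / D2 *)
  (F : {mpoly K[3]}) (def_F : F * D2 K q = D1 K q)
  (* L = K(x, y) is the function field of the curve F = 0 *)
  (L : fieldType) (iota : {rmorphism K -> L}) (x y : L)
  (L_ff : function_field iota F x y)
  (D : nat -> L -> L) (D_hasse : hasse_derivatives iota x D)
  (* the point P of the curve, identified with the place v centered at it *)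
  (P : 'rV[K]_3) (P_on : on_curve F P)
  (v : L -> int) (v_place : place iota v) (v_center : center iota x y v P) :
  (rational_over (q ^ 3) P -> SV_coef iota q D x y v 1) /\
  (~ rational_over (q ^ 3) P -> SV_coef iota q D x y v 0).
Proof.
have q_gt1 : (1 < q)%N by exact: ltnW.
have K_pchar : [pchar K].-nat q.
  have Fq_p : p \in [pchar Fq] by apply: card_finPcharP p_prime; rewrite card_Fq def_q.
  by rewrite def_q pnatX pnatE // (rmorph_pchar emb Fq_p).
have L_pchar : [pchar L].-nat q by rewrite (eq_pnat _ (fmorph_pchar iota)).
have xy_gen := function_field_generates L_ff.
have xy_D1 := ff_affine_D1 def_F L_ff.
have xy_D2 : affine_D2 q x y != 0.
  by have [a [b [ab1 ab2]]] := exists_affine_point K_pchar q_gt1;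
    exact: (ff_affine_D2 def_F L_ff ab1 ab2).
have exp_q3 (a : K) : a ^+ (q ^ 3) = ((a ^+ q) ^+ q) ^+ q.
  by rewrite !expnS expn0 muln1 !exprM.
pose i0 : 'I_3 := Ordinal (isT : 0 < 3)%N.
pose i1 : 'I_3 := Ordinal (isT : 1 < 3)%N.
pose i2 : 'I_3 := Ordinal (isT : 2 < 3)%N.
have ord3 (i : 'I_3) : [\/ i = i0, i = i1 | i = i2].
  by case: i => -[|[|[|//]]] ?; [apply: Or31 | apply: Or32 | apply: Or33];
    apply: val_inj.
have [t t0 t_res] := v_center.
have t_residue i : residue iota v (t * tnth [tuple x; y; 1] i) (P 0 i).
  by case: (t_res i) => [t_i|t_i]; [left | right; rewrite -gtz0_ge1].
have x_res := t_residue i0; have y_res := t_residue i1; have z_res := t_residue i2.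
rewrite !(tnth_nth 0) /= mulr1 in x_res y_res z_res.
(* An element of F_(q^2) that is also fixed by the q^3-power map lies in F_q. *)
have no_rational a : ((a ^+ q) ^+ q) = a -> a ^+ q != a ->
    forall i j, a = P 0 i / P 0 j -> ~ rational_over (q ^ 3) P.
  move=> aE /eqP an i j aP /(rational_over_ratio i j).
  by rewrite -aP exp_q3 aE.
have cusp_case : SV_coef iota q D x y v 0 -> ~ rational_over (q ^ 3) P ->
    (rational_over (q ^ 3) P -> SV_coef iota q D x y v 1) /\
    (~ rational_over (q ^ 3) P -> SV_coef iota q D x y v 0) by [].
have [P2|P2] := eqVneq (P 0 i2) 0.
  have [P0|P0] := eqVneq (P 0 i0) 0.
    (* The center would be (0 : 1 : 0), which is F_q-rational: impossible. *)
    have P1 : P 0 i1 != 0.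
      apply: contraNneq (proj1 P_on) => P1; apply/eqP/rowP => i; rewrite mxE.
      by case: (ord3 i) => ->.
    have y_inv := residueV v_place y_res P1.
    have y0 : y != 0.
      by apply: contraNneq xy_D2 => ->; rewrite affine_D2C affine_D20 ?oppr0 // ltnW.
    have u_res := residueM v_place x_res y_inv;
      have w_res := residueM v_place z_res y_inv.
    rewrite P0 P2 !mul0r -mulf_div divff // mul1r in u_res w_res.
    rewrite invfM mulrA divff // mul1r in w_res.
    have z_q : (0 : K) ^+ q = 0 by rewrite expr0n eqn0Ngt ltnW.
    have yx_D1 : affine_D1 q (x / y) y^-1 = 0.
      by rewrite affine_D1_infinity // affine_D1C xy_D1 oppr0 mul0r.
    have := rational_center_affine_D2 v_place L_pchar q_gt1 u_res w_res z_q z_q yx_D1.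
    rewrite affine_D2_infinity // affine_D2C => /eqP.
    by rewrite mulf_eq0 oppr_eq0 (negPf xy_D2) invr_eq0 !mulf_eq0 !expf_eq0 (negPf
      y0) !andbF.
  have x_inv := residueV v_place x_res P0.
  have x0 : x != 0.
    by apply: contraNneq xy_D2 => ->; rewrite affine_D20 // ltnW.
  have u_res := residueM v_place y_res x_inv;
    have w_res := residueM v_place z_res x_inv.
  rewrite -mulf_div divff // mul1r in u_res.
  rewrite P2 mul0r invfM mulrA divff // mul1r in w_res.
  have z_q : (0 : K) ^+ q = 0 by rewrite expr0n eqn0Ngt ltnW.
  have [aE|an] := eqVneq ((P 0 i1 / P 0 i0) ^+ q) (P 0 i1 / P 0 i0).
    (* The center would again be F_q-rational, now in the chart (y/x, 1/x). *)
    have yx_D1 : affine_D1 q (y / x) x^-1 = 0.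
      by rewrite affine_D1_infinity // xy_D1 mul0r.
    have := rational_center_affine_D2 v_place L_pchar q_gt1 u_res w_res aE z_q yx_D1.
    rewrite affine_D2_infinity // => /eqP.
    by rewrite mulf_eq0 (negPf xy_D2) invr_eq0 !mulf_eq0 !expf_eq0 (negPf x0) !andbF.
  have [aE S0] := SV_coef_infinite_cusp v_place L_pchar q_gt1 D_hasse xy_gen xy_D1
    xy_D2 u_res w_res an.
  by apply: cusp_case => //; exact: no_rational aE an _ _ erefl.
have z_inv := residueV v_place z_res P2.
have xa := residueM v_place x_res z_inv; have yb := residueM v_place y_res z_inv.
rewrite ![t * _]mulrC !mulfK // in xa yb.
have [ab2|ab2] := eqVneq (affine_D2 q (P 0 i0 / P 0 i2) (P 0 i1 / P 0 i2)) 0.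
  have [aE|an] := eqVneq ((P 0 i0 / P 0 i2) ^+ q) (P 0 i0 / P 0 i2).
    have [bE|bn] := eqVneq ((P 0 i1 / P 0 i2) ^+ q) (P 0 i1 / P 0 i2).
      have /eqP := rational_center_affine_D2 v_place L_pchar q_gt1 xa yb aE bE xy_D1.
      by rewrite (negPf xy_D2).
    have [bE S0] := SV_coef_vertical_cusp v_place L_pchar q_gt1 D_hasse xy_gen xy_D1
      xy_D2 xa yb aE bn.
    by apply: cusp_case => //; exact: no_rational bE bn _ _ erefl.
  have [aE S0] := SV_coef_cusp v_place L_pchar q_gt1 D_hasse xy_gen xy_D1 xy_D2 xa yb
    ab2 an.
  by apply: cusp_case => //; exact: no_rational aE an _ _ erefl.
have := SV_coef_smooth v_place L_pchar q_gt1 D_hasse xy_gen xy_D1 xy_D2 xa yb ab2.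
have [aE|an] := eqVneq; last first.
  move=> S0; split=> // /(rational_over_ratio i0 i2); rewrite exp_q3 => aE.
  by rewrite aE eqxx in an.
move=> S1; split=> // nrat; case: nrat.
(* To contradict [nrat]: once a^(q^3) = a, the equation D1 = 0 forces b^(q^3) = b, and dividing by
   the last coordinate exhibits P as F_(q^3)-rational. *)
have ab1 : affine_D1 q (P 0 i0 / P 0 i2) (P 0 i1 / P 0 i2) = 0.
  by apply: (residue_eq0 v_place); rewrite -xy_D1; exact: (residue_affine_D1 v_place).
have bE := smooth_rational K_pchar q_gt1 ab1 ab2 aE.
exists (P 0 i2)^-1; rewrite ?invr_neq0 // => i; rewrite mulrC exp_q3.
by case: (ord3 i) => ->; rewrite // divff // !expr1n.
Qed.
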